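(* Let $b\in\mathbb{C}$ with $b^2\neq 4$ and let $\mathcal{M}_b=\mathrm{Spec}\big(\mathbb{C}[x_1,x_2,x_3]/(t-b)\big)$, where $t=-2+x_1^2+x_2^2+x_3^2-x_1x_2x_3$. Then the second algebraic de Rham cohomology $\mathrm{H}^2$ of $\mathcal{M}_b$ has dimension $h^2=5$ over $\mathbb{C}$, and the classes of the $2$-forms $$x_1\,dx_2\wedge dx_3,\quad x_1^2\,dx_2\wedge dx_3,\quad x_1x_2\,dx_2\wedge dx_3,\quad x_1x_3\,dx_2\wedge dx_3,\quad x_1^3\,dx_2\wedge dx_3$$ form a $\mathbb{C}$-basis of it.
   Context: For an affine variety $U$ over $\mathbb{C}$, $(\Omega_U^\bullet,d)$ is its algebraic de Rham complex (global Kähler differential forms) with differentials $d_i:\Omega_U^i\to\Omega_U^{i+1}$, and $\mathrm{H}^i=\ker(d_i)/\mathrm{im}(d_{i-1})$, $h^i=\dim_{\mathbb{C}}\mathrm{H}^i$. $\mathcal{M}_b$ is the relative $\mathrm{SL}(2,\mathbb{C})$-representation variety of the one-holed torus with boundary trace $b$; it is smooth exactly when $b^2\ne4$. In the paper the basis is written $\{1,x_1,x_2,x_3,x_1^2\}\otimes(x_1dx_{23})$. *)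

(* Defs.v *)
From HB Require Import structures.
From mathcomp Require Import all_boot all_algebra.
From mathcomp Require Import boolp reals.
From mathcomp Require Import complex.
From mathcomp Require Import ring_quotient.
From mathcomp.multinomials Require Import freeg mpoly.

Set Implicit Arguments.
Unset Strict Implicit.
Unset Printing Implicit Defensive.

Import GRing.Theory Num.Theory.
Local Open Scope ring_scope.
Local Open Scope quotient_scope.

Section Submodules.
Variables (R : nzRingType) (V : lmodType R).

(* [span S] is the submodule generated by S. *)
Definition span (S : V -> Prop) : V -> bool := fun v =>
  `[< exists s : seq (R * V),
        (forall p, p \in s -> S p.2) /\ v = \sum_(p <- s) p.1 *: p.2 >].

Fact span_subsemimod_closed S : subsemimod_closed (span S).
Proof.
split=> [|a v /asboolP[s [Ss ->]]].
  split=> [|u v /asboolP[s [Ss ->]] /asboolP[r [Sr ->]]]; apply/asboolP.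
    by exists [::]; rewrite big_nil.
  exists (s ++ r); rewrite big_cat; split=> // p.
  by rewrite mem_cat => /orP[/Ss|/Sr].
apply/asboolP; exists [seq (a * p.1, p.2) | p <- s]; split.
  by move=> _ /mapP[p /Ss ? ->].
by rewrite big_map scaler_sumr; apply: eq_bigr => p _; rewrite scalerA.
Qed.

HB.instance Definition _ S :=
  GRing.isSubmodClosed.Build R V (span S) (span_subsemimod_closed S).

Lemma mem_span (S : V -> Prop) v : S v -> v \in span S.
Proof.
move=> Sv; apply/asboolP; exists [:: (1, v)]; split.
  by move=> p; rewrite inE => /eqP->.
by rewrite big_seq1 scale1r.
Qed.

Fact submod_zmod_closed (N : submodClosed V) : zmod_closed N.
Proof.
split=> [|u v Nu Nv]; first exact: rpred0.
by rewrite -scaleN1r rpredD // rpredZ.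
Qed.

(* [submodClosed] does not inherit from [zmodClosed], which [Quotient.quot] needs. *)
Definition submod_pred (N : submodClosed V) : V -> bool := fun v => v \in N.

HB.instance Definition _ N :=
  GRing.isZmodClosed.Build V (submod_pred N) (submod_zmod_closed N).

Definition submod_zmod (N : submodClosed V) : zmodClosed V :=
  GRing.ZmodClosed.clone V (submod_pred N) _.

Definition modquot (N : submodClosed V) := Quotient.quot (submod_zmod N).

Variable N : submodClosed V.

HB.instance Definition _ := GRing.Zmodule.on (modquot N).
HB.instance Definition _ := Quotient.on (modquot N).

Definition mproj (v : V) : modquot N := \pi_(modquot N) v.

Lemma mprojP u v : reflect (mproj u = mproj v) (u - v \in N).
Proof.
apply: (iffP idP) => [Nuv|/eqP].
  by apply/eqP; rewrite -(Quotient.idealrBE (submod_zmod N)).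
by rewrite -(Quotient.idealrBE (submod_zmod N)).
Qed.

Definition modquot_scale (a : R) (x : modquot N) : modquot N :=
  mproj (a *: repr x).

Lemma mproj_surj (x : modquot N) : mproj (repr x) = x.
Proof. exact: reprK. Qed.

Fact mproj_is_zmod_morphism : zmod_morphism mproj.
Proof. exact: (raddfB \pi_(Quotient.quot (submod_zmod N))). Qed.

HB.instance Definition _ :=
  GRing.isZmodMorphism.Build V (modquot N) mproj mproj_is_zmod_morphism.

Fact modquot_scaleE a v : modquot_scale a (mproj v) = mproj (a *: v).
Proof.
by apply/mprojP; rewrite -scalerBr rpredZ //; apply/mprojP/mproj_surj.
Qed.

Fact modquot_scaleA a b x :
  modquot_scale a (modquot_scale b x) = modquot_scale (a * b) x.
Proof. by rewrite -(mproj_surj x) !modquot_scaleE scalerA. Qed.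

Fact modquot_scale1 : left_id 1 modquot_scale.
Proof. by move=> x; rewrite -(mproj_surj x) !modquot_scaleE scale1r. Qed.

Fact modquot_scaleDr : right_distributive modquot_scale +%R.
Proof.
move=> a x y; rewrite -(mproj_surj x) -(mproj_surj y) -raddfD.
by rewrite !modquot_scaleE scalerDr raddfD.
Qed.

Fact modquot_scaleDl x : {morph modquot_scale^~ x : a b / a + b}.
Proof.
by move=> a b; rewrite -(mproj_surj x) !modquot_scaleE scalerDl raddfD.
Qed.

HB.instance Definition _ := GRing.Zmodule_isLmodule.Build R (modquot N)
  modquot_scaleA modquot_scale1 modquot_scaleDr modquot_scaleDl.

Fact mproj_is_scalable : scalable mproj.
Proof. by move=> a v; rewrite -modquot_scaleE. Qed.

HB.instance Definition _ :=
  GRing.isScalable.Build R V (modquot N) *:%R mproj mproj_is_scalable.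

End Submodules.

Section QuotientAlgebra.
Variables (K : comNzRingType) (P : comAlgType K) (I : idealr P).

Definition quotalg := {ideal_quot I}.

HB.instance Definition _ := GRing.ComNzRing.on quotalg.
HB.instance Definition _ := Quotient.on quotalg.

Definition qproj (p : P) : quotalg := \pi_quotalg p.

Fact qproj_is_zmod_morphism : zmod_morphism qproj.
Proof. exact: (raddfB \pi_{ideal_quot I}). Qed.

Fact qproj_is_monoid_morphism : monoid_morphism qproj.
Proof.
by split; [exact: (rmorph1 \pi_{ideal_quot I})
          |exact: (rmorphM \pi_{ideal_quot I})].
Qed.

HB.instance Definition _ :=
  GRing.isZmodMorphism.Build P quotalg qproj qproj_is_zmod_morphism.
HB.instance Definition _ :=
  GRing.isMonoidMorphism.Build P quotalg qproj qproj_is_monoid_morphism.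

Definition quotalg_scale (c : K) (x : quotalg) : quotalg := qproj c%:A * x.

Fact quotalg_scaleA c1 c2 x :
  quotalg_scale c1 (quotalg_scale c2 x) = quotalg_scale (c1 * c2) x.
Proof.
by rewrite /quotalg_scale mulrA -rmorphM -scalerAl mul1r scalerA.
Qed.

Fact quotalg_scale1 : left_id 1 quotalg_scale.
Proof. by move=> x; rewrite /quotalg_scale scale1r rmorph1 mul1r. Qed.

Fact quotalg_scaleDr : right_distributive quotalg_scale +%R.
Proof. by move=> c x y; rewrite /quotalg_scale mulrDr. Qed.

Fact quotalg_scaleDl x : {morph quotalg_scale^~ x : a b / a + b}.
Proof. by move=> a b; rewrite /quotalg_scale scalerDl rmorphD mulrDl. Qed.

HB.instance Definition _ := GRing.Zmodule_isLmodule.Build K quotalg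
  quotalg_scaleA quotalg_scale1 quotalg_scaleDr quotalg_scaleDl.

Fact quotalg_scaleAl (c : K) (x y : quotalg) : c *: (x * y) = c *: x * y.
Proof. exact: mulrA. Qed.

HB.instance Definition _ :=
  GRing.Lmodule_isLalgebra.Build K quotalg quotalg_scaleAl.
HB.instance Definition _ := GRing.Lalgebra_isComAlgebra.Build K quotalg.

End QuotientAlgebra.

Section RestrictionOfScalars.
Variables (K : comNzRingType) (A : comAlgType K).

Definition restr (V : lmodType A) : Type := V.

Variable V : lmodType A.

HB.instance Definition _ := GRing.Zmodule.on (restr V).

Definition restr_scale (c : K) (v : restr V) : restr V := (c%:A : A) *: (v : V).

Fact restr_scaleA c1 c2 v :
  restr_scale c1 (restr_scale c2 v) = restr_scale (c1 * c2) v.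
Proof. by rewrite /restr_scale scalerA -scalerAl mul1r scalerA. Qed.

Fact restr_scale1 : left_id 1 restr_scale.
Proof. by move=> v; rewrite /restr_scale !scale1r. Qed.

Fact restr_scaleDr : right_distributive restr_scale +%R.
Proof. by move=> c u v; rewrite /restr_scale scalerDr. Qed.

Fact restr_scaleDl v : {morph restr_scale^~ v : a b / a + b}.
Proof. by move=> a b; rewrite /restr_scale !scalerDl. Qed.

HB.instance Definition _ := GRing.Zmodule_isLmodule.Build K (restr V)
  restr_scaleA restr_scale1 restr_scaleDr restr_scaleDl.

End RestrictionOfScalars.

Section DeRham.
Variables (K : comNzRingType) (A : comAlgType K).

Definition upd n (t : n.-tuple A) (i : 'I_n) (a : A) : n.-tuple A :=
  [tuple if j == i then a else tnth t j | j < n].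

(* The symbol [<< t >>] stands for da_1 /\ ... /\ da_n with t = (a_1,...,a_n);
   the relations present the n-th exterior power over A of the module of
   Kaehler differentials of A over K. *)
Inductive kahler_rel n : {freeg (n.-tuple A) / A} -> Prop :=
| KahlerAdd t i a b :
    kahler_rel (<< upd t i (a + b) >> - << upd t i a >> - << upd t i b >>)
| KahlerConst t i (c : K) :
    kahler_rel << upd t i c%:A >>
| KahlerLeibniz t i a b :
    kahler_rel (<< upd t i (a * b) >>
                - << a *g upd t i b >> - << b *g upd t i a >>)
| KahlerAlt t i j :
    i != j -> tnth t i = tnth t j -> kahler_rel << t >>.

Definition kahler_submod n : submodClosed {freeg (n.-tuple A) / A} :=
  GRing.SubmodClosed.clone _ _ (span (@kahler_rel n)) _.

(* [OmegaA n] is the A-module of n-forms, and [Omega n] below is the same group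
   with its K-linear structure, for which the differential is linear. *)
Definition OmegaA n := modquot (kahler_submod n).

Definition wedge n (t : n.-tuple A) : OmegaA n := mproj _ << t >>.

Fact kahler_eq0 n D : @kahler_rel n D -> mproj (kahler_submod n) D = 0.
Proof.
move=> relD; rewrite -(raddf0 (mproj (kahler_submod n))).
by apply/mprojP; rewrite subr0; apply: mem_span.
Qed.

Fact freegUZ n a (t : n.-tuple A) : << a *g t >> = a *: << t >> :> {freeg _ / A}.
Proof.
by apply/eqP/freeg_eqP => u; rewrite coeffZ !coeffU mul1r.
Qed.

Lemma wedgeD n (t : n.-tuple A) i a b :
  wedge (upd t i (a + b)) = wedge (upd t i a) + wedge (upd t i b).
Proof.
apply/eqP; rewrite -subr_eq0 opprD addrA -!raddfB.
by apply/eqP/kahler_eq0/KahlerAdd.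
Qed.

Lemma wedge_const n (t : n.-tuple A) i (c : K) : wedge (upd t i c%:A) = 0.
Proof. exact/kahler_eq0/KahlerConst. Qed.

Lemma wedgeM n (t : n.-tuple A) i a b :
  wedge (upd t i (a * b)) = a *: wedge (upd t i b) + b *: wedge (upd t i a).
Proof.
apply/eqP; rewrite -subr_eq0 opprD addrA -!linearZ -!raddfB -!freegUZ.
by apply/eqP/kahler_eq0/KahlerLeibniz.
Qed.

Lemma wedge_alt n (t : n.-tuple A) i j :
  i != j -> tnth t i = tnth t j -> wedge t = 0.
Proof. by move=> ij tij; apply/kahler_eq0/(KahlerAlt ij). Qed.

Fact cons_upd n (t : n.-tuple A) a i b :
  [tuple of a :: upd t i b] = upd [tuple of a :: t] (fintype.lift ord0 i) b.
Proof.
apply: eq_from_tnth => j; rewrite tnth_mktuple.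
case: (unliftP ord0 j) => [k|] ->; last by rewrite !tnth0.
by rewrite !tnthS tnth_mktuple (inj_eq lift_inj).
Qed.

Fact consE n (t : n.-tuple A) a :
  [tuple of a :: t] = upd [tuple of 0 :: t] ord0 a.
Proof.
apply: eq_from_tnth => j; rewrite tnth_mktuple.
by case: (unliftP ord0 j) => [k|] ->; rewrite ?tnth0 ?tnthS.
Qed.

Fact wedge_swap n (t : n.-tuple A) i a b :
  wedge [tuple of a :: upd t i b] + wedge [tuple of b :: upd t i a] = 0.
Proof.
have alt c : wedge [tuple of c :: upd t i c] = 0.
  apply: (@wedge_alt _ _ ord0 (fintype.lift ord0 i)); first by rewrite neq_lift.
  by rewrite tnth0 tnthS tnth_mktuple eqxx.
have consD c e (u : n.-tuple A) : wedge [tuple of c + e :: u]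
    = wedge [tuple of c :: u] + wedge [tuple of e :: u].
  by rewrite consE wedgeD -!consE.
have := alt (a + b); rewrite consD !cons_upd !wedgeD -!cons_upd !alt.
by rewrite add0r addr0.
Qed.

(* Not A-linear, so not an instance of [fglift]. *)
Definition dfree n (D : {freeg (n.-tuple A) / A}) : OmegaA n.+1 :=
  \sum_(t <- dom D) wedge [tuple of coeff t D :: t].

Fact wedge_cons0 n (t : n.-tuple A) : wedge [tuple of 0 :: t] = 0.
Proof. by rewrite consE -(scale0r 1) wedge_const. Qed.

Fact wedge_consB n (t : n.-tuple A) a b :
  wedge [tuple of a - b :: t]
  = wedge [tuple of a :: t] - wedge [tuple of b :: t].
Proof.
apply/eqP; rewrite eq_sym subr_eq; apply/eqP.
by rewrite consE [in RHS]consE [X in _ + wedge X]consE -wedgeD subrK.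
Qed.

Fact dfreeE n (D : {freeg (n.-tuple A) / A}) (s : seq (n.-tuple A)) :
  uniq s -> {subset dom D <= s} ->
  dfree D = \sum_(t <- s) wedge [tuple of coeff t D :: t].
Proof.
move=> Us sDs; rewrite /dfree.
rewrite [RHS](bigID (fun t => t \in dom D)) /= [X in _ = _ + X]big1 => [|t].
  rewrite addr0 -[RHS]big_filter; apply: perm_big.
  apply: uniq_perm; rewrite ?filter_uniq ?uniq_dom // => t.
  rewrite mem_filter; case: (boolP (t \in dom D)) => //= /sDs -> //.
by move/coeff_outdom => ->; rewrite wedge_cons0.
Qed.

Fact dfree_is_zmod_morphism n : zmod_morphism (@dfree n).
Proof.
move=> D1 D2; pose s := undup (dom D1 ++ dom D2).
rewrite !(@dfreeE _ _ s) ?undup_uniq //.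
- rewrite -sumrB; apply: eq_bigr => t _.
  by rewrite coeffB wedge_consB.
- by move=> t; rewrite mem_undup mem_cat orbC => ->.
- by move=> t; rewrite mem_undup mem_cat => ->.
by move=> t /domB; rewrite mem_undup.
Qed.

HB.instance Definition _ n := GRing.isZmodMorphism.Build
  {freeg (n.-tuple A) / A} (OmegaA n.+1) (@dfree n) (@dfree_is_zmod_morphism n).

Fact dfreeU n a (t : n.-tuple A) :
  dfree << a *g t >> = wedge [tuple of a :: t].
Proof.
have [->|a0] := eqVneq a 0.
  by rewrite freegU0 raddf0 wedge_cons0.
by rewrite /dfree domU // big_seq1 coeffU eqxx mulr1.
Qed.

Fact dfree_span n D : D \in kahler_submod n -> dfree D = 0.
Proof.
move=> /asboolP[s [relS ->]]; rewrite raddf_sum big_seq big1 // => -[a E] /=.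
move/relS => /= [{E}t i b c|t i c|t i b c|t i j ij tij].
- rewrite !scalerBr !raddfB /= -!freegUZ !dfreeU !cons_upd wedgeD.
  by rewrite -addrA -opprD subrr.
- by rewrite -freegUZ dfreeU cons_upd wedge_const.
- have cM x y (u : n.-tuple A) : wedge [tuple of x * y :: u]
      = x *: wedge [tuple of y :: u] + y *: wedge [tuple of x :: u].
    by rewrite consE wedgeM -!consE.
  rewrite !scalerBr !raddfB /= [<< b *g _ >>]freegUZ [<< c *g _ >>]freegUZ.
  rewrite !scalerA -!freegUZ !dfreeU !cM cons_upd wedgeM -!cons_upd.
  have /eqP := wedge_swap t i b c; rewrite addr_eq0 => /eqP ->.
  by rewrite scalerN -addrA -opprD addrACA addNr add0r subrr.
by rewrite -freegUZ dfreeU (@wedge_alt _ _ (fintype.lift ord0 i)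
  (fintype.lift ord0 j)) ?tnthS ?(inj_eq lift_inj).
Qed.

Definition Omega n := restr (OmegaA n).

HB.instance Definition _ n := GRing.Lmodule.on (Omega n).

(* [diff_form a (a_1,...,a_n)] is the n-form a da_1 /\ ... /\ da_n. *)
Definition diff_form n (a : A) (t : n.-tuple A) : Omega n := a *: wedge t.

(* [repr] picks a lift to the free module: [dE] shows that the choice does not
   matter, and [d_form] that d (a da_1 /\ ...) = da /\ da_1 /\ ... *)
Definition d n (w : Omega n) : Omega n.+1 := dfree (repr (w : OmegaA n)).

Fact dE n D : d (mproj (kahler_submod n) D : Omega n) = dfree D.
Proof.
apply/eqP; rewrite -subr_eq0 -raddfB; apply/eqP/dfree_span.
by apply/mprojP; rewrite mproj_surj.
Qed.

Lemma d_form n a (t : n.-tuple A) :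
  d (diff_form a t) = diff_form 1 [tuple of a :: t].
Proof. by rewrite /diff_form scale1r /wedge -linearZ dE -freegUZ dfreeU. Qed.

Fact d_is_zmod_morphism n : zmod_morphism (@d n).
Proof.
move=> u v; rewrite -(mproj_surj (u : OmegaA n)) -(mproj_surj (v : OmegaA n)).
by rewrite -[_ - _]raddfB !dE raddfB.
Qed.

HB.instance Definition _ n := GRing.isZmodMorphism.Build
  (Omega n) (Omega n.+1) (@d n) (@d_is_zmod_morphism n).

Fact dfree_scale n c D : @dfree n (c%:A *: D) = (c%:A : A) *: dfree D.
Proof.
rewrite -(freeg_sumE D) !raddf_sum.
apply: eq_bigr => t _ /=; rewrite dfreeU.
rewrite consE wedgeM -!consE [X in _ + X](_ : _ = 0) ?addr0 //.
by rewrite consE wedge_const scaler0.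
Qed.

Fact d_is_scalable n : scalable (@d n).
Proof.
move=> c w; rewrite -(mproj_surj (w : OmegaA n)) dE.
by rewrite -[RHS]dfree_scale -dE linearZ.
Qed.

HB.instance Definition _ n := GRing.isScalable.Build
  K (Omega n) (Omega n.+1) *:%R (@d n) (@d_is_scalable n).

Lemma dd n (w : Omega n) : d (d w) = 0.
Proof.
have d_wedge m (t : m.-tuple A) : d (wedge t : Omega m) = 0.
  have one : 1 = (1 : K)%:A :> A by rewrite scale1r.
  rewrite -[wedge t]scale1r (d_form 1 t) /diff_form consE [X in upd _ _ X]one.
  by rewrite wedge_const scaler0.
rewrite -(mproj_surj (w : OmegaA n)) dE /dfree.
by rewrite [LHS](raddf_sum (@d n.+1)) big1 // => t _; apply: d_wedge.
Qed.

Definition closed_form n : Omega n -> bool := fun w => d w == 0.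

Fact closed_subsemimod_closed n : subsemimod_closed (@closed_form n).
Proof.
split=> [|c w /eqP dw]; last by apply/eqP; rewrite linearZ /= dw scaler0.
split=> [|u v /eqP du /eqP dv]; apply/eqP; first by rewrite raddf0.
by rewrite raddfD /= du dv addr0.
Qed.

HB.instance Definition _ n := GRing.isSubmodClosed.Build
  K (Omega n) (@closed_form n) (@closed_subsemimod_closed n).

Record cocycle n :=
  Cocycle { cocycle_val : Omega n; _ : closed_form cocycle_val }.

HB.instance Definition _ n := [isSub for @cocycle_val n].
HB.instance Definition _ n := [Choice of cocycle n by <:].
HB.instance Definition _ n := [SubChoice_isSubLmodule of cocycle n by <:].

Fact cocycle_valD n (u v : cocycle n) :
  cocycle_val (u + v) = cocycle_val u + cocycle_val v.
Proof. exact: (raddfD val). Qed.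

Fact cocycle_valZ n c (u : cocycle n) :
  cocycle_val (c *: u) = c *: cocycle_val u.
Proof. exact: GRing.valZ. Qed.

Definition exact_form n : Omega n -> Prop :=
  match n with
  | 0 => fun w => w = 0
  | m.+1 => fun w => exists eta : Omega m, w = d eta
  end.

Definition coboundary n : cocycle n -> bool :=
  fun z => `[< exact_form (cocycle_val z) >].

Fact coboundary_subsemimod_closed n : subsemimod_closed (@coboundary n).
Proof.
case: n => [|n]; split=> [|c w /asboolP].
- split=> [|u v /asboolP /= u0 /asboolP /= v0].
    exact/asboolP.
  by apply/asboolP; rewrite /exact_form cocycle_valD u0 v0 addr0.
- by move=> /= w0; apply/asboolP; rewrite /exact_form cocycle_valZ w0 scaler0.
- split=> [|u v /asboolP[x ux] /asboolP[y vy]]; apply/asboolP.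
    by exists 0; rewrite raddf0.
  by exists (x + y); rewrite cocycle_valD raddfD /= ux vy.
case=> x wx; apply/asboolP; exists (c *: x).
by rewrite cocycle_valZ linearZ /= wx.
Qed.

HB.instance Definition _ n := GRing.isSubmodClosed.Build
  K (cocycle n) (@coboundary n) (@coboundary_subsemimod_closed n).

Definition coboundary_submod n : submodClosed (cocycle n) :=
  GRing.SubmodClosed.clone _ _ (@coboundary n) _.

Definition HdR n := modquot (coboundary_submod n).

HB.instance Definition _ n := GRing.Lmodule.on (HdR n).

Definition cohomology_class n (w : Omega n) (dw : closed_form w) : HdR n :=
  mproj (coboundary_submod n) (Cocycle dw).

End DeRham.

Section Bases.
Variables (K : fieldType) (V : lmodType K).

Definition is_basis m (e : 'I_m -> V) : Prop :=
  (forall c : 'I_m -> K, \sum_i c i *: e i = 0 -> forall i, c i = 0) /\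
  (forall v : V, exists c : 'I_m -> K, v = \sum_i c i *: e i).

Definition has_dim (m : nat) : Prop := exists e : 'I_m -> V, is_basis e.

End Bases.

Section Surface.
Variables (R : realType) (b : R[i]).

Definition X1 : {mpoly R[i][3]} := 'X_(@Ordinal 3 0 isT).
Definition X2 : {mpoly R[i][3]} := 'X_(@Ordinal 3 1 isT).
Definition X3 : {mpoly R[i][3]} := 'X_(@Ordinal 3 2 isT).

Definition trace_poly : {mpoly R[i][3]} :=
  - 2 + X1 ^+ 2 + X2 ^+ 2 + X3 ^+ 2 - X1 * X2 * X3.

(* The ideal (t - b), as a classically decided predicate. *)
Definition Mb_ideal : {mpoly R[i][3]} -> bool :=
  fun p => `[< exists q, p = q * (trace_poly - b%:MP) >].

Fact Mb_ideal_closed : idealr_closed Mb_ideal.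
Proof.
split=> [||a u v /asboolP[p ->] /asboolP[q ->]]; apply/asboolP.
- by exists 0; rewrite mul0r.
- move=> [q]; pose s := 2.-root (b + 2).
  pose z (i : 'I_3) := if i == @Ordinal 3 0 isT then s else 0.
  move/(congr1 (fun p => p.@[z])).
  have x1z : X1.@[z] = s by rewrite mevalXU.
  have x2z : X2.@[z] = 0 by rewrite mevalXU.
  have tz : (trace_poly - b%:MP).@[z] = 0.
    have x3z : X3.@[z] = 0 by rewrite mevalXU.
    rewrite /trace_poly !expr2 !(mevalB, mevalD, mevalM, mevalN, mevalMn).
    rewrite !mevalC x1z x2z x3z !mulr0 subr0 !addr0 -expr2 sqrtCK.
    by rewrite [b + _]addrC addKr subrr.
  by rewrite meval1 mevalM tz mulr0 => /eqP; rewrite oner_eq0.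
by exists (a * p + q); rewrite mulrDl mulrA.
Qed.

HB.instance Definition _ :=
  isIdealr.Build {mpoly R[i][3]} Mb_ideal Mb_ideal_closed.

Definition Mb_idealr : idealr {mpoly R[i][3]} :=
  Idealr.clone _ Mb_ideal _.

(* The coordinate ring of the affine surface M_b. *)
Definition Mb : comAlgType R[i] := quotalg Mb_idealr.

Definition Mb_x1 : Mb := qproj Mb_idealr X1.
Definition Mb_x2 : Mb := qproj Mb_idealr X2.
Definition Mb_x3 : Mb := qproj Mb_idealr X3.

End Surface.

(* Main.v *)
From HB Require Import structures.
Require Import Defs.
From mathcomp Require Import all_boot all_algebra.
From mathcomp Require Import boolp reals.
From mathcomp Require Import complex.
From mathcomp Require Import ring_quotient.
From mathcomp Require Import ring zify.
From mathcomp.multinomials Require Import freeg mpoly.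

Set Implicit Arguments.
Unset Strict Implicit.
Unset Printing Implicit Defensive.

Import GRing.Theory Num.Theory.
Local Open Scope ring_scope.

(** Put c = b + 2 and F = x1^2 + x2^2 + x3^2 - x1 x2 x3 - c, so that the surface
    is F = 0; let P be the ring of polynomials in x1, x2, x3, and write d_i for
    the partial derivatives and F_i for d_i F.

    The exterior derivative of a lift to affine space sends the two-form
    a dr ds to the Jacobian determinant of (a, r, s) times dx1 dx2 dx3. Two lifts
    of the same form differ by an element of F Omega^2 + dF Omega^1, which is a
    multiple of F up to exact forms, and the derivative of F (g1 dx2 dx3 +
    g2 dx3 dx1 + g3 dx1 dx2) is the sum of the d_i (F g_i). By the Poincare lemma
    on affine space, two-forms modulo exact forms are thus the quotient of P by
    d_1 (F P) + d_2 (F P) + d_3 (F P), and the five forms of the theorem become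
    1, 2 x1, x2, x3, 3 x1^2. Both halves of the theorem are statements about this
    quotient.

    Generation. Applied to monomials, the relations d_i (F g) rewrite any monomial
    of degree at least 3 by monomials of smaller degree, except that a power of one
    variable is first rewritten by mixed monomials of the same degree
    ([cubic_reduction]). Antiderivatives carry this back to forms
    ([two_forms_reduce], [all_spanned]).

    Independence. There is a linear functional on P that kills all d_i (F g) and
    takes any prescribed values on 1, x1, x2, x3, x1^2 ([cubic_functional]). It is
    given by its moments, the values on monomials. The relations for d_2 express all
    moments by those without x2; the latter must be killed by the operators
    D d_i + (3/2) (d_i D) for i = 1, 3, where D is the discriminant of F as a
    quadratic polynomial in x2, and they are again built by recursion. Each of these
    two systems of recurrences is overdetermined, and its consistency comes from the
    identity O_i^s O_j^(s+1) = O_j^s O_i^(s+1) for the operators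
    O_i^s g = D (d_i g) + s (d_i D) g, and likewise with F for D ([rel1_rel2],
    [xrel_zrel]): if a functional kills the image of O_i^s, then its composite with
    O_j^s kills the image of O_i^(s+1), and modulo that image every polynomial
    reduces to monomials on which the composite is directly seen to vanish.
    Through the Jacobian determinant such a functional becomes a functional on
    two-forms that vanishes on exact forms ([form_functional_exact]), and five of
    them separate the five classes.

    The five forms are closed because all three-forms vanish: b^2 - 4 = c^2 - 4 c
    is a combination of F, F_1, F_2, F_3 ([jacobian_ideal]), which kill
    dx1 dx2 dx3. *)

(** * Linear extension from monomials, and antiderivatives *)

(** [fglift] extends only maps that are linear in the coefficient. On two-forms
    the coefficient enters through its own derivatives, so the extension below asks
    for additivity alone. *)
Section FreeSums.
Variables (A : nzRingType) (T : choiceType) (G : zmodType) (f : T -> A -> G).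
Hypothesis fB : forall t, {morph f t : a b / a - b}.

Definition free_sum (D : {freeg T / A}) : G := \sum_(t <- dom D) f t (coeff t D).

Let f0 t : f t 0 = 0. Proof. by rewrite -[0 in LHS](subrr 0) fB subrr. Qed.

Lemma free_sumE (D : {freeg T / A}) (s : seq T) :
  uniq s -> {subset dom D <= s} -> free_sum D = \sum_(t <- s) f t (coeff t D).
Proof.
move=> Us sDs; rewrite [RHS](bigID (fun t => t \in dom D)) /=.
rewrite [X in _ = _ + X]big1 => [|t /coeff_outdom -> //].
rewrite addr0 -[RHS]big_filter; apply/perm_big/uniq_perm.
- exact: uniq_dom.
- exact: filter_uniq.
by move=> t; rewrite mem_filter; case: (boolP (t \in dom D)) => //= /sDs.
Qed.

Fact free_sum_is_zmod_morphism : zmod_morphism free_sum.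
Proof.
move=> D1 D2; pose s := undup (dom D1 ++ dom D2).
rewrite !(@free_sumE _ s) ?undup_uniq //.
- by rewrite -sumrB; apply: eq_bigr => t _; rewrite coeffB fB.
- by move=> t; rewrite mem_undup mem_cat orbC => ->.
- by move=> t; rewrite mem_undup mem_cat => ->.
by move=> t /domB; rewrite mem_undup.
Qed.

Lemma free_sumU a t : free_sum << a *g t >> = f t a.
Proof.
have [->|a0] := eqVneq a 0; first by rewrite freegU0 /free_sum dom0 big_nil f0.
by rewrite /free_sum domU // big_seq1 coeffU eqxx mulr1.
Qed.

End FreeSums.

Section LinearExtension.
Variables (K : nzRingType) (n : nat) (V : lmodType K) (u : 'X_{1..n} -> V).

Definition mextend (p : {mpoly K[n]}) : V :=
  free_sum (fun m a => a *: u m) (mpoly_val p).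

Fact mextend_is_zmod_morphism : zmod_morphism mextend.
Proof. by move=> p q; apply: free_sum_is_zmod_morphism => t a b; apply: scalerBl. Qed.

HB.instance Definition _ := GRing.isZmodMorphism.Build _ _ mextend mextend_is_zmod_morphism.

Lemma mextendZX a m : mextend (a *: 'X_[m]) = a *: u m.
Proof.
rewrite -(free_sumU (f := fun m a => a *: u m)) => [|t x y]; last exact: scalerBl.
by rewrite /mextend; congr free_sum; apply/eqP/freeg_eqP => k;
  rewrite -mcoeff_MPoly mpoly_valK mcoeffZ mcoeffX coeffU eq_sym.
Qed.

Lemma mextendE p : mextend p = \sum_(m <- msupp p) p@_m *: u m.
Proof.
rewrite {1}(mpolyE p) raddf_sum.
by apply: eq_bigr => m _; apply: mextendZX.
Qed.

Fact mextend_is_scalable : scalable mextend.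
Proof.
move=> a p; rewrite [X in _ = _ *: X]mextendE {1}(mpolyE p) !scaler_sumr raddf_sum.
by apply: eq_bigr => m _ /=; rewrite !scalerA mextendZX.
Qed.

HB.instance Definition _ := GRing.isScalable.Build _ _ _ _ mextend mextend_is_scalable.

Lemma mextendX m : mextend 'X_[m] = u m.
Proof. by rewrite -['X_[m]]scale1r mextendZX scale1r. Qed.

End LinearExtension.

Section Antiderivative.
Variables (K : numFieldType) (n : nat).
Implicit Types (i j : 'I_n) (p : {mpoly K[n]}).

(** The antiderivative along one variable that has no term free of it. *)
Definition antideriv i : {mpoly K[n]} -> {mpoly K[n]} :=
  mextend (fun m => (m i).+1%:R^-1 *: 'X_[m + U_(i)]).

Lemma linear_eq_on_monomials (V : lmodType K) (f g : {linear {mpoly K[n]} -> V}) :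
  (forall m, f 'X_[m] = g 'X_[m]) -> f =1 g.
Proof.
move=> fg p; rewrite (mpolyE p) !linear_sum; apply: eq_bigr => m _.
by rewrite !linearZ /= fg.
Qed.

Lemma antiderivK i p : (antideriv i p)^`M(i) = p.
Proof.
apply: (linear_eq_on_monomials (f := mderiv i \o mextend _) (g := idfun)) => m /=.
rewrite mextendX mderivZ mderivX mnmDE mnm1E eqxx addn1 scalerA mulVf ?pnatr_eq0 //.
by rewrite scale1r addmK.
Qed.

Lemma mderiv_antideriv i j p : i != j ->
  (antideriv i p)^`M(j) = antideriv i p^`M(j).
Proof.
move=> ij; apply: (linear_eq_on_monomials (f := mderiv j \o mextend _)
  (g := mextend _ \o mderiv j)) => m /=.
rewrite mextendX mderivX mderivZ mderivX mextendZX.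
rewrite mnmDE mnmBE !mnm1E (negPf ij) eq_sym (negPf ij) addn0 subn0 !scalerA mulrC.
have [-> | mj] := eqVneq (m j) 0; first by rewrite !mul0r !scale0r.
congr (_ *: 'X_[_]); apply/mnmP => k; rewrite !(mnmDE, mnmBE, mnm1E).
have [<- | _] := eqVneq j k; have [ik | _] := eqVneq i k; lia.
Qed.

End Antiderivative.

(** * The cubic and its relations on monomials *)

Local Notation i1 := (@Ordinal 3 0 isT).
Local Notation i2 := (@Ordinal 3 1 isT).
Local Notation i3 := (@Ordinal 3 2 isT).

Section MonomialRelations.
Variables (K : nzRingType) (c : K) (V : lmodType K).
Implicit Type u : nat -> nat -> nat -> V.

(** These are d_1 (F m), d_2 (F m), d_3 (F m) for the monomial m with exponents
    i, j, k, where [u] stands for the family of monomials; see [cubic_rel1]. When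
    i = 0 the truncated exponent [i.-1] is harmless, as its coefficient is zero.
    Keeping [u] general allows moments in place of monomials. *)
Definition rel1 u (i j k : nat) : V :=
  (i.+2)%:R *: u i.+1 j k - (i.+1)%:R *: u i j.+1 k.+1
  + i%:R *: (u i.-1 j.+2 k + u i.-1 j k.+2 - c *: u i.-1 j k).

Definition rel2 u (i j k : nat) : V :=
  rel1 (fun j i k => u i j k) j i k.

Definition rel3 u (i j k : nat) : V :=
  rel1 (fun k j i => u i j k) k j i.

End MonomialRelations.

(* Powers with symbolic exponents become atoms for [ring]. *)
Ltac powers_ring :=
  repeat match goal with |- context [?a ^+ ?n] => generalize (a ^+ n) => ? end; ring.

Lemma ord3P (Q : 'I_3 -> Prop) : Q i1 -> Q i2 -> Q i3 -> forall i, Q i.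
Proof.
move=> Q1 Q2 Q3 [[|[|[|i]]] //= lt_i]; [have := Q1 | have := Q2 | have := Q3];
  by congr Q; apply/val_inj.
Qed.

(** Locked to keep unification from unfolding polynomial arithmetic. *)
HB.lock Definition cubic (K : numFieldType) (c : K) : {mpoly K[3]} :=
  'X_i1 ^+ 2 + 'X_i2 ^+ 2 + 'X_i3 ^+ 2 - 'X_i1 * 'X_i2 * 'X_i3 - c%:MP.

Section Cubic.
Variables (K : numFieldType) (c : K).

Local Notation P := {mpoly K[3]}.
Local Notation x := ('X_i1 : P).
Local Notation y := ('X_i2 : P).
Local Notation z := ('X_i3 : P).

Definition mon (i j k : nat) : P := x ^+ i * y ^+ j * z ^+ k.

Lemma mderivXi (i j : 'I_3) : ('X_i : P)^`M(j) = (i == j)%:R.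
Proof.
rewrite mderivX mnm1E; have [->|] := eqVneq i j; last by rewrite scale0r.
rewrite scale1r (_ : (U_(j) - U_(j))%MM = 0%MM) ?mpolyX0 //.
by apply/mnmP => k; rewrite mnmBE subnn mnm0E.
Qed.

Lemma mderivXn (p : P) (i : 'I_3) n : (p ^+ n)^`M(i) = n%:R * p ^+ n.-1 * p^`M(i).
Proof.
elim: n => [|n IH]; first by rewrite expr0 -mpolyC1 mderivC !mul0r.
rewrite exprS mderivM IH; case: n {IH} => [|n] /=; first by rewrite expr0; ring.
by rewrite exprS; ring.
Qed.

Definition mderivE := (mderivM, mderivD, mderivN, mderivC, mderivXn, mderivXi).

Lemma cubic_mderiv1 : (cubic c)^`M(i1) = 2 * x - y * z.
Proof. rewrite cubic.unlock !mderivE /=; ring. Qed.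
Lemma cubic_mderiv2 : (cubic c)^`M(i2) = 2 * y - x * z.
Proof. rewrite cubic.unlock !mderivE /=; ring. Qed.
Lemma cubic_mderiv3 : (cubic c)^`M(i3) = 2 * z - x * y.
Proof. rewrite cubic.unlock !mderivE /=; ring. Qed.

Lemma cubic_rel1 i j k : (cubic c * mon i j k)^`M(i1) = rel1 c mon i j k.
Proof.
rewrite mderivM cubic_mderiv1 /rel1 /mon cubic.unlock -!mul_mpolyC !mderivE /= !mpolyC_nat.
case: i => [|i] /=; rewrite !exprS ?expr0; powers_ring.
Qed.

Lemma cubic_rel2 i j k : (cubic c * mon i j k)^`M(i2) = rel2 c mon i j k.
Proof.
rewrite mderivM cubic_mderiv2 /rel2 /rel1 /mon cubic.unlock -!mul_mpolyC !mderivE /= !mpolyC_nat.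
case: j => [|j] /=; rewrite !exprS ?expr0; powers_ring.
Qed.

Lemma cubic_rel3 i j k : (cubic c * mon i j k)^`M(i3) = rel3 c mon i j k.
Proof.
rewrite mderivM cubic_mderiv3 /rel3 /rel1 /mon cubic.unlock -!mul_mpolyC !mderivE /= !mpolyC_nat.
case: k => [|k] /=; rewrite !exprS ?expr0; powers_ring.
Qed.

Lemma mpolyX_mon m : 'X_[m] = mon (m i1) (m i2) (m i3).
Proof.
rewrite mpolyXE_id !big_ord_recl big_ord0 mulr1 mulrA /mon.
have -> : ord0 = i1 :> 'I_3 by apply/val_inj.
have -> : fintype.lift i1 (@ord0 1) = i2 by apply/val_inj.
by have -> : fintype.lift i1 (fintype.lift ord0 (@ord0 0)) = i3 by apply/val_inj.
Qed.

End Cubic.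

(** * Reduction to five monomials *)

Section Reduction.
Variables (K : numFieldType) (c : K).
Local Notation P := {mpoly K[3]}.
Variable Q : P -> Prop.
Hypothesis QD : forall p q, Q p -> Q q -> Q (p + q).
Hypothesis QZ : forall a p, Q p -> Q (a *: p).

Let QB p q : Q p -> Q q -> Q (p - q).
Proof. by move=> Qp Qq; apply: QD => //; rewrite -scaleN1r; apply: QZ. Qed.

Let Q_div n p : Q (n.+1%:R *: p) -> Q p.
Proof. by move=> /(QZ n.+1%:R^-1); rewrite scalerA mulVf ?pnatr_eq0 // scale1r. Qed.

(** Solving the first relation for its leading term, the monomial divisible by
    x2 x3: the other terms have smaller degree. *)
Lemma mixed_reduces (u : nat -> nat -> nat -> P) i j k :
  Q (rel1 c u i j k) -> Q (u i.+1 j k) ->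
  (0 < i -> [/\ Q (u i.-1 j.+2 k), Q (u i.-1 j k.+2) & Q (u i.-1 j k)])%N ->
  Q (u i j.+1 k.+1).
Proof.
move=> Qr Q1 Qlow; apply: (@Q_div i).
have Qs : Q (i%:R *: (u i.-1 j.+2 k + u i.-1 j k.+2 - c *: u i.-1 j k)).
  case: i Q1 Qlow {Qr} => [Q1 _ | i _ /(_ isT) [Qa Qb Qc]].
    by rewrite scale0r -(scale0r (u 1 j k)); apply: QZ.
  by apply: QZ; apply: QB; [apply: QD | apply: QZ].
have -> : i.+1%:R *: u i j.+1 k.+1 = i.+2%:R *: u i.+1 j k
  + i%:R *: (u i.-1 j.+2 k + u i.-1 j k.+2 - c *: u i.-1 j k) - rel1 c u i j k.
  rewrite /rel1 -!mul_mpolyC !mpolyC_nat; ring.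
by apply: QB => //; apply: QD => //; apply: QZ.
Qed.

(** The relations d_1 (F x1^(n+1)) and d_2 (F x1^n x2) share the term
    x1^(n+1) x2 x3; eliminating it leaves x1^(n+2) as the combination of
    x1^n x2^2 and terms with coefficient n. *)
Lemma power_reduces (u : nat -> nat -> nat -> P) n :
  Q (rel1 c u n.+1 0 0) -> Q (rel2 c u n 1 0) ->
  Q (u n 2 0) -> (0 < n -> Q (u n 0 2) /\ Q (u n 0 0))%N -> Q (u n.+2 0 0)%N.
Proof.
move=> Q1 Q2 Qy Qz; apply: (@Q_div n.+3).
have Qs : Q (n%:R *: (u n 0 2 - c *: u n 0 0)).
  case: n Qz {Q1 Q2} Qy => [_ Qy | n /(_ isT) [Qa Qb] _].
    by rewrite scale0r -(scale0r (u 0 2 0)); apply: QZ.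
  by apply: QZ; apply: QB => //; apply: QZ.
have -> : n.+4%:R *: u n.+2 0 0 = 2 *: rel1 c u n.+1 0 0 - n.+2%:R *: rel2 c u n 1 0
  + n.+4%:R *: u n 2 0 - n%:R *: (u n 0 2 - c *: u n 0 0).
  rewrite /rel2 /rel1 -!mul_mpolyC !mpolyC_nat /=; ring.
by apply: QB => //; apply: QD; [apply: QB; apply: QZ | apply: QZ].
Qed.

Lemma rel1_tr (u : nat -> nat -> nat -> P) i j k :
  rel1 c (fun i k j => u i j k) i k j = rel1 c u i j k.
Proof. by rewrite /rel1 [u i.-1 j k.+2 + _]addrC. Qed.

(** Induction on the degree. A monomial in two variables at least reduces to
    smaller degree. A power m >= 3 of one variable reduces to mixed monomials of
    the same degree, and the three squares reduce to each other. *)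
Lemma monomials_reduce (u : nat -> nat -> nat -> P) :
  (forall i j k, Q (rel1 c u i j k)) -> (forall i j k, Q (rel2 c u i j k)) ->
  (forall i j k, Q (rel3 c u i j k)) ->
  Q (u 0 0 0) -> Q (u 1 0 0) -> Q (u 0 1 0) -> Q (u 0 0 1) -> Q (u 2 0 0) ->
  forall i j k, Q (u i j k).
Proof.
move=> R1 R2 R3 Q0 Qx Qy Qz Qxx i j k.
have [n le_n] := ubnP (i + j + k); elim: n => // n IH in i j k le_n *.
have mixed1 i' j' k' : (i' + j'.+1 + k'.+1 < n.+1)%N -> Q (u i' j'.+1 k'.+1).
  move=> lt_n; apply: mixed_reduces => //; first by apply: IH; lia.
  by case: i' lt_n => // i' lt_n _; split; apply: IH => /=; lia.
have mixed2 i' j' k' : (i'.+1 + j' + k'.+1 < n.+1)%N -> Q (u i'.+1 j' k'.+1).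
  move=> lt_n; apply: (@mixed_reduces (fun j i k => u i j k)) => //.
  - exact: R2.
  - by apply: IH; lia.
  by case: j' lt_n => // j' lt_n _; split; apply: IH => /=; lia.
have mixed3 i' j' k' : (i'.+1 + j'.+1 + k' < n.+1)%N -> Q (u i'.+1 j'.+1 k').
  move=> lt_n; apply: (@mixed_reduces (fun k j i => u i j k)) => //.
  - exact: R3.
  - by apply: IH; lia.
  by case: k' lt_n => // k' lt_n _; split; apply: IH => /=; lia.
have powx m : (m.+2 < n.+1)%N -> Q (u m 2 0) -> Q (u m.+2 0 0).
  move=> lt_n Qm; apply: power_reduces => // m_gt0; split; last by apply: IH; lia.
  by case: m m_gt0 lt_n {Qm} => // m _ lt_n; apply: mixed2; lia.
have powy m : (m.+2 < n.+1)%N -> Q (u 2 m 0) -> Q (u 0 m.+2 0).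
  move=> lt_n Qm; apply: (@power_reduces (fun j i k => u i j k)) => //.
  - exact: R2.
  - exact: R1.
  move=> m_gt0; split; last by apply: IH; lia.
  by case: m m_gt0 lt_n {Qm} => // m _ lt_n; apply: mixed1; lia.
have powz m : (m.+2 < n.+1)%N -> Q (u 2 0 m) -> Q (u 0 0 m.+2).
  move=> lt_n Qm; apply: (@power_reduces (fun k i j => u i j k)) => //.
  - by rewrite (rel1_tr (fun k j i => u i j k)); apply: R3.
  - by rewrite /rel2 (rel1_tr (fun i j k => u i j k)); apply: R1.
  move=> m_gt0; split; last by apply: IH; lia.
  by case: m m_gt0 lt_n {Qm} => // m _ lt_n; apply: mixed1; lia.
case: i j k le_n => [|i] [|j] [|k] le_n //;
  try by [apply: mixed1 | apply: mixed2 | apply: mixed3].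
- case: k le_n => [//|k] le_n; apply: powz; first lia.
  by case: k le_n => // k le_n; apply: mixed2; lia.
- case: j le_n => [//|j] le_n; apply: powy; first lia.
  by case: j le_n => // j le_n; apply: mixed3; lia.
case: i le_n => [//|i] le_n; case: i le_n => // i le_n.
by apply: powx; [lia | apply: mixed3; lia].
Qed.

End Reduction.

Theorem cubic_reduction (K : numFieldType) (c : K) (Q : {mpoly K[3]} -> Prop) :
  (forall p q, Q p -> Q q -> Q (p + q)) -> (forall a p, Q p -> Q (a *: p)) ->
  (forall g i, Q (cubic c * g)^`M(i)) ->
  Q 1 -> Q 'X_i1 -> Q 'X_i2 -> Q 'X_i3 -> Q ('X_i1 ^+ 2) -> forall p, Q p.
Proof.
move=> QD QZ Qd Q1 Qx Qy Qz Qxx p.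
have Q0 : Q 0 by rewrite -(scale0r 1); apply: QZ.
rewrite (mpolyE p); elim/big_ind: _ => // m _; apply: (QZ); rewrite mpolyX_mon.
apply: (@monomials_reduce K c Q QD QZ (@mon K)) => //; rewrite /mon ?mul1r ?mulr1 //.
- by move=> i j k; rewrite -cubic_rel1.
- by move=> i j k; rewrite -cubic_rel2.
by move=> i j k; rewrite -cubic_rel3.
Qed.

(** * Moments in two variables *)

(** Reduces an identity that follows linearly from a known one to a ring
    identity. *)
Lemma eq_of_multiple (K : nzRingType) (k x y z t : K) : x = y -> z - t = k * (x - y) -> z = t.
Proof. by move=> -> /eqP; rewrite subrr mulr0 subr_eq0 => /eqP. Qed.

Lemma two_step (T : nat -> Prop) :
  T 0 -> T 1 -> (forall n, T n -> T n.+1 -> T n.+2) -> forall n, T n.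
Proof.
move=> T0 T1 TS n; suff [] : T n /\ T n.+1 by [].
by elim: n => [|n [Tn Tn1]]; split=> //; apply: TS.
Qed.

Section PlaneMoments.
Variables (K : numFieldType) (c : K).

(** The value of N on D (d_1 g) + (3/2) (d_1 D) g for g = x1^p x3^q, where N is
    regarded as a linear functional given on monomials and
    D = x1^2 x3^2 - 4 x1^2 - 4 x3^2 + 4 c is the discriminant of F with respect
    to x2. *)
Definition xrel (N : nat -> nat -> K) (p q : nat) : K :=
  (p.+3)%:R * N p.+1 q.+2 - 4 * p%:R * N p.-1 q.+2
  - 4 * (p.+3)%:R * N p.+1 q + 4 * c * p%:R * N p.-1 q.

(** The pair (N p 0, N p 2). The relation of d_3 at (p, 1) and that of d_1 at
    (p + 1, 0) both involve N (p + 2) 2; eliminating it yields N (p + 2) 0. By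
    symmetry the same sequence, with other initial values, is (N 0 q, N 2 q). *)
Fixpoint edge (s0 s1 s2 : K) (p : nat) : K * K :=
  match p with
  | 0 => (s0, s2)
  | 1 => (s1, 4 * s1)
  | p'.+2 => let: (s, r) := edge s0 s1 s2 p' in
      let s' := (4 * r + p'%:R * c * s) / (p'.+4)%:R in
      (s', s' + 4 * r - c * s)
  end.

(** Row q + 2 out of row [v] = q, from the relations of d_1; these leave the
    entry [h] in column 0 free. *)
Fixpoint next_row (v : nat -> K) (h : K) (p : nat) : K :=
  match p with
  | 0 => h
  | 1 => 4 * v 1
  | p'.+2 => (4 * (p'.+1)%:R * next_row v h p' + 4 * (p'.+4)%:R * v p'.+2
              - 4 * c * (p'.+1)%:R * v p') / (p'.+4)%:R
  end.

Variables s0 s1 t1 s2 e : K.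

(** Row 1 has no predecessor; the relations of d_3 at (p, 0) determine it from
    its first two entries. *)
Fixpoint row1 (p : nat) : K :=
  match p with 0 => t1 | 1 => e | p'.+2 => 4 * row1 p' end.

Fixpoint rows (q : nat) : nat -> K :=
  match q with
  | 0 => fun p => (edge s0 s1 s2 p).1
  | 1 => row1
  | q'.+2 => next_row (rows q') (edge s0 t1 s2 q'.+2).1
  end.

Definition moment2 (p q : nat) : K := rows q p.

Let nz n : (n.+1)%:R != 0 :> K. Proof. by rewrite pnatr_eq0. Qed.

Lemma next_row_rel v h p :
  (p.+4)%:R * next_row v h p.+2 = 4 * (p.+1)%:R * next_row v h p + 4 * (p.+4)%:R * v p.+2
              - 4 * c * (p.+1)%:R * v p.
Proof. by rewrite /= mulrC divfK. Qed.

Lemma edge_rel1 a0 a1 a2 p :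
  (p.+4)%:R * (edge a0 a1 a2 p.+2).1
  = 4 * (edge a0 a1 a2 p).2 + p%:R * c * (edge a0 a1 a2 p).1.
Proof. by rewrite /=; case: (edge a0 a1 a2 p) => s r /=; rewrite mulrC divfK. Qed.

Lemma edge_rel2 a0 a1 a2 p :
  (edge a0 a1 a2 p.+2).2
  = (edge a0 a1 a2 p.+2).1 + 4 * (edge a0 a1 a2 p).2 - c * (edge a0 a1 a2 p).1.
Proof. by rewrite /=; case: (edge a0 a1 a2 p). Qed.

Lemma edge2 a0 a1 a2 : (edge a0 a1 a2 2).1 = a2.
Proof. by apply: (mulfI (nz 3)); rewrite edge_rel1 /=; ring. Qed.

Lemma moment2_xrel p q : xrel moment2 p q = 0.
Proof.
rewrite /xrel /moment2 [rows q.+2]/=; case: p => [|p].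
  rewrite /=; ring.
rewrite [p.+1.-1]/= next_row_rel; ring.
Qed.

Lemma moment2_row p : moment2 p 2 = (edge s0 s1 s2 p).2.
Proof.
elim/two_step: p => [||p IH _]; first exact: edge2.
  by [].
apply: (mulfI (nz p.+3)); rewrite {1}/moment2 [rows 2]/= next_row_rel.
rewrite -[next_row _ _ p]/(moment2 p 2) IH edge_rel2 -/edge.
apply: (@eq_of_multiple _ 3 _ _ _ _ (edge_rel1 s0 s1 s2 p)); ring.
Qed.

Lemma moment2_col q : moment2 0 q = (edge s0 t1 s2 q).1.
Proof. by case: q => [|[|q]]. Qed.

Lemma moment2_col2 q : moment2 2 q = (edge s0 t1 s2 q).2.
Proof.
elim/two_step: q => [||q IH _]; first exact: edge2.
  by [].
apply: (mulfI (nz 3)); rewrite {1}/moment2 [rows q.+2]/= next_row_rel.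
rewrite -[rows q 2]/(moment2 2 q) IH -[rows q 0]/(moment2 0 q) moment2_col.
rewrite edge_rel2; set s' := (edge _ _ _ q.+2).1.
rewrite -[next_row _ _ 0]/s'; ring.
Qed.

Definition zrel (N : nat -> nat -> K) (p q : nat) : K := xrel (fun q p => N p q) q p.

(** The operators D d_i + s (d_i D) satisfy O_1^s O_3^(s+1) = O_3^s O_1^(s+1);
    here s = 3/2, and both sides are evaluated by N at x1^p x3^q. *)
Lemma xrel_zrel N p q :
  (p.+4.+1)%:R * zrel N p.+1 q.+2 - 4 * p%:R * zrel N p.-1 q.+2
  - 4 * (p.+4.+1)%:R * zrel N p.+1 q + 4 * c * p%:R * zrel N p.-1 q
  = (q.+4.+1)%:R * xrel N p.+2 q.+1 - 4 * q%:R * xrel N p.+2 q.-1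
  - 4 * (q.+4.+1)%:R * xrel N p q.+1 + 4 * c * q%:R * xrel N p q.-1.
Proof. rewrite /zrel /xrel; case: p => [|p]; case: q => [|q] /=; ring. Qed.

(** Once the relations of d_1 hold, [xrel_zrel] is a recurrence for the values
    [zrel], so that they vanish as soon as they do on column 0 and on rows 0 and 1,
    where the choice of the initial values was made for that purpose. *)
Lemma moment2_zrel p q : zrel moment2 p q = 0.
Proof.
have zrel0 r : zrel moment2 0 r = 0.
  rewrite /zrel /xrel; case: r => [|r].
    rewrite !moment2_col !moment2_col2 /=; ring.
  rewrite !moment2_col !moment2_col2 edge_rel2 /=.
  apply: (@eq_of_multiple _ (- 3) _ _ _ _ (edge_rel1 s0 t1 s2 r)); ring.
elim/two_step: q p => [||q IH0 IH1] p.
- by rewrite /zrel /xrel /moment2 /=; ring.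
- rewrite /zrel /xrel !moment2_row [1.-1]/= edge_rel2 /moment2 [rows 0]/=.
  ring.
elim/two_step: p => [||p IHp _] //.
  have := xrel_zrel moment2 0 q; rewrite !moment2_xrel IH0 !(mulr0, mul0r, addr0, subr0) => /eqP.
  by rewrite mulf_eq0 (negPf (nz _)) => /eqP.
have := xrel_zrel moment2 p.+1 q; rewrite !moment2_xrel !IH0 IHp !(mulr0, addr0, subr0) => /eqP.
by rewrite mulf_eq0 (negPf (nz _)) => /eqP.
Qed.

End PlaneMoments.

(** * Moments in three variables *)

Section SpaceMoments.
Variables (K : numFieldType) (c : K).

Variable N : nat -> nat -> K.

(** The relation of d_2 solved for the highest power of x2, starting from the
    moments N without x2. *)
Fixpoint lift_moment (j i k : nat) : K :=
  match j with
  | 0 => N i k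
  | 1 => N i.+1 k.+1 / 2
  | (j'.+1 as j1).+1 => ((j'.+2)%:R * lift_moment j1 i.+1 k.+1
              - (j'.+1)%:R * (lift_moment j' i.+2 k + lift_moment j' i k.+2
                              - c * lift_moment j' i k)) / (j'.+3)%:R
  end.

Definition moment3 (i j k : nat) : K^o := lift_moment j i k.

Let nz n : (n.+1)%:R != 0 :> K. Proof. by rewrite pnatr_eq0. Qed.

Lemma moment3_rel2 i j k : rel2 c moment3 i j k = 0.
Proof.
rewrite /rel2 /rel1 /moment3 /GRing.scale /=; case: j => [|j].
  by rewrite /= mulrC divfK ?(nz 1) // mul0r addr0 mul1r subrr.
rewrite /= [X in X - _]mulrC divfK //; ring.
Qed.

(** The identity O_1^s O_2^(s+1) = O_2^s O_1^(s+1) for O_i^s = F d_i + s F_i with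
    s = 1, evaluated by [u] at x1^i x2^j x3^k. *)
Lemma rel1_rel2 (u : nat -> nat -> nat -> K^o) i j k :
  (j.+4)%:R * rel1 c u i j.+1 k - (j.+2)%:R * rel1 c u i.+1 j k.+1
  + j%:R * (rel1 c u i.+2 j.-1 k + rel1 c u i j.-1 k.+2 - c * rel1 c u i j.-1 k)
  = (i.+4)%:R * rel2 c u i.+1 j k - (i.+2)%:R * rel2 c u i j.+1 k.+1
  + i%:R * (rel2 c u i.-1 j.+2 k + rel2 c u i.-1 j k.+2 - c * rel2 c u i.-1 j k).
Proof.
rewrite /rel2 /rel1 /GRing.scale; case: i => [|i]; case: j => [|j] /=; ring.
Qed.

Hypothesis N_xrel : forall p q, xrel c N p q = 0.

(** By [rel1_rel2] it suffices to treat j = 0, where eliminating x2 turns the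
    relation of d_1 into the hypothesis on N. *)
Lemma moment3_rel1 i j k : rel1 c moment3 i j k = 0.
Proof.
have rel0 i' k' : rel1 c moment3 i' 0 k' = 0.
  (* For m free of x2, the relations of d_2 turn x2 m into x1 x3 m / 2 and x2^2 m
     into (x1^2 x3^2 - x1^2 - x3^2 + c) m / 3; the factor comes from this. *)
  apply: (@eq_of_multiple _ (- 1 / 6) _ _ _ _ (N_xrel i' k')).
  rewrite /xrel /rel1 /moment3 /GRing.scale /=.
  by case: i' => [|i'] /=; field.
elim/two_step: j i k => [||j IH0 IH1] i k //.
  have := rel1_rel2 moment3 i 0 k.
  rewrite rel0 !moment3_rel2 !(mulr0, mul0r, addr0, subr0) => /eqP.
  by rewrite mulf_eq0 (negPf (nz _)) => /eqP.
have := rel1_rel2 moment3 i j.+1 k.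
rewrite IH1 !IH0 !moment3_rel2 !(mulr0, addr0, subr0) => /eqP.
by rewrite mulf_eq0 (negPf (nz _)) => /eqP.
Qed.

End SpaceMoments.

(** The cubic is symmetric in x1 and x3, so the relations of d_3 for N are those
    of d_1 for the transpose of N. *)
Lemma lift_moment_tr (K : numFieldType) (c : K) N j i k :
  lift_moment c N j i k = lift_moment c (fun q p => N p q) j k i.
Proof.
have step M n p q : lift_moment c M n.+2 p q
    = ((n.+2)%:R * lift_moment c M n.+1 p.+1 q.+1
       - (n.+1)%:R * (lift_moment c M n p.+2 q + lift_moment c M n p q.+2
                      - c * lift_moment c M n p q)) / (n.+3)%:R by [].
elim/two_step: j i k => [||j IH0 IH1] i k //.
by rewrite !step IH1 !IH0 [lift_moment c _ j k.+2 i + _]addrC.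
Qed.

Lemma moments_exist (K : numFieldType) (c v0 vx vy vz vxx : K) :
  exists u : nat -> nat -> nat -> K^o,
    [/\ forall i j k, rel1 c u i j k = 0, forall i j k, rel2 c u i j k = 0
      & forall i j k, rel3 c u i j k = 0]
    /\ [/\ u 0 0 0 = v0, u 1 0 0 = vx, u 0 1 0 = vy, u 0 0 1 = vz & u 2 0 0 = vxx].
Proof.
(* The relation of d_2 at 1 gives u 0 1 0 = N 1 1 / 2, whence the factor 2. *)
pose N := moment2 c v0 vx vz vxx (2 * vy).
exists (moment3 c N); split; split=> //.
- by move=> i j k; apply: moment3_rel1 => p q; apply: moment2_xrel.
- by move=> i j k; apply: moment3_rel2.
- move=> i j k; rewrite /rel3.
  transitivity (rel1 c (moment3 c (fun q p => N p q)) k j i).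
    by rewrite /rel1 /moment3 !(lift_moment_tr c N).
  by apply: moment3_rel1 => p q; apply: moment2_zrel.
- by rewrite /moment3 /= /N /moment2 /= mulrC mulKf ?pnatr_eq0.
exact: edge2.
Qed.

Lemma linear_moments (K : numFieldType) (u : nat -> nat -> nat -> K^o) :
  exists phi : {linear {mpoly K[3]} -> K^o}, forall i j k, phi (mon K i j k) = u i j k.
Proof.
pose phi := mextend (fun m : 'X_{1..3} => u (m i1) (m i2) (m i3)).
exists phi => i j k.
rewrite -(_ : 'X_[ [multinom nth 0 [:: i; j; k] l | l < 3] ] = mon K i j k).
  by apply: etrans (mextendX _ _) _; rewrite !mnmE.
by rewrite mpolyX_mon !mnmE.
Qed.

Theorem cubic_functional (K : numFieldType) (c v0 vx vy vz vxx : K) :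
  exists phi : {linear {mpoly K[3]} -> K^o},
    (forall g i, phi (cubic c * g)^`M(i) = 0) /\
    [/\ phi 1 = v0, phi 'X_i1 = vx, phi 'X_i2 = vy, phi 'X_i3 = vz
      & phi ('X_i1 ^+ 2) = vxx].
Proof.
have [u [[R1 R2 R3] [u0 ux uy uz uxx]]] := moments_exist c v0 vx vy vz vxx.
have [phi phi_mon] := linear_moments u.
have phiE a b d (p q r s t : {mpoly K[3]}) : phi (a *: p - b *: q + d *: (r + s - c *: t))
    = a *: phi p - b *: phi q + d *: (phi r + phi s - c *: phi t).
  by rewrite (raddfD phi) (raddfB phi) /= !(linearZ_LR phi)
       (raddfB phi) (raddfD phi) /= (linearZ_LR phi).
exists phi; split=> [g i|].
  have -> : (cubic c * g)^`M(i)
      = \sum_(m <- msupp g) g@_m *: (cubic c * mon K (m i1) (m i2) (m i3))^`M(i).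
    rewrite {1}(mpolyE g) mulr_sumr (raddf_sum (mderiv i)); apply: eq_bigr => m _.
    by rewrite -scalerAr mpolyX_mon; apply: mderivZ.
  rewrite (raddf_sum phi) big1 // => m _ /=.
  rewrite (linearZ_LR phi); set i' := m i1; set j' := m i2; set k' := m i3.
  elim/ord3P: i.
  - by rewrite cubic_rel1 /rel1 phiE !phi_mon -[RHS](scaler0 _ g@_m) -(R1 i' j' k').
  - by rewrite cubic_rel2 /rel2 /rel1 phiE !phi_mon -[RHS](scaler0 _ g@_m) -(R2 i' j' k').
  - by rewrite cubic_rel3 /rel3 /rel1 phiE !phi_mon -[RHS](scaler0 _ g@_m) -(R3 i' j' k').
by split; [rewrite -u0 | rewrite -ux | rewrite -uy | rewrite -uz | rewrite -uxx];
  rewrite -phi_mon /mon ?mul1r ?mulr1.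
Qed.

(** * The coordinate ring *)

Section CoordinateRing.
Variables (R : realType) (b : R[i]).
Local Notation K := R[i].
Local Notation P := {mpoly K[3]}.
Local Notation A := (Mb b).
Local Notation F := (cubic (b + 2) : P).

(** Restriction of polynomials to the surface. *)
Definition res (p : P) : A := qproj (Mb_idealr b) p.

HB.instance Definition _ := GRing.RMorphism.copy res (qproj (Mb_idealr b)).

Lemma cubic_trace : trace_poly R - b%:MP = F.
Proof. rewrite /trace_poly cubic.unlock /X1 /X2 /X3 mpolyCD mpolyC_nat. ring. Qed.

Lemma res_scale a p : res (a *: p) = a *: res p.
Proof.
rewrite -mul_mpolyC rmorphM -[a%:MP]mulr1 mul_mpolyC /=; congr (_ * _).
Qed.

Lemma res_const a : res a%:MP = a%:A.
Proof. by rewrite -[a%:MP]mulr1 mul_mpolyC res_scale rmorph1. Qed.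

Lemma res_repr (x : A) : res (repr x) = x.
Proof. exact: reprK. Qed.

Lemma res_F g : res (F * g) = 0.
Proof.
rewrite -(rmorph0 res); apply/eqP; rewrite -(Quotient.idealrBE (Mb_idealr b)) subr0.
by apply/asboolP; exists g; rewrite cubic_trace mulrC.
Qed.

Lemma res_eq p q : res p = res q -> exists g, p = q + F * g.
Proof.
move/eqP; rewrite -(Quotient.idealrBE (Mb_idealr b)) => /asboolP[g].
by rewrite cubic_trace => /eqP; rewrite subr_eq addrC mulrC => /eqP ->; exists g.
Qed.

End CoordinateRing.

(** * Linear functionals on two-forms *)

(** The coefficient of dp dq dr on dx1 dx2 dx3; locked for the same reason as
    [cubic]. *)
HB.lock Definition jac (K : comNzRingType) (p q r : {mpoly K[3]}) : {mpoly K[3]} :=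
  p^`M(i1) * (q^`M(i2) * r^`M(i3) - q^`M(i3) * r^`M(i2))
  - p^`M(i2) * (q^`M(i1) * r^`M(i3) - q^`M(i3) * r^`M(i1))
  + p^`M(i3) * (q^`M(i1) * r^`M(i2) - q^`M(i2) * r^`M(i1)).

Section Jacobian.
Variables (K : comNzRingType).
Local Notation P := {mpoly K[3]}.
Implicit Types p q r : P.

Lemma jac_tr12 p q r : jac q p r = - jac p q r.
Proof. rewrite jac.unlock; ring. Qed.

Lemma jac_tr23 p q r : jac p r q = - jac p q r.
Proof. rewrite jac.unlock; ring. Qed.

Lemma jacD p p' q r : jac (p + p') q r = jac p q r + jac p' q r.
Proof. rewrite jac.unlock !mderivD; ring. Qed.

Lemma jacB p p' q r : jac (p - p') q r = jac p q r - jac p' q r.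
Proof. rewrite jac.unlock !mderivB; ring. Qed.

Lemma jacDm p q q' r : jac p (q + q') r = jac p q r + jac p q' r.
Proof. rewrite jac.unlock !mderivD; ring. Qed.

Lemma jac_constm p (a : K) r : jac p a%:MP r = 0.
Proof. rewrite jac.unlock !mderivC; ring. Qed.

Lemma jac_diag p q : jac p q q = 0.
Proof. rewrite jac.unlock; ring. Qed.

Lemma jac_leibniz a p q r : jac a (p * q) r = jac (a * p) q r + jac (a * q) p r.
Proof. rewrite jac.unlock !mderivM; ring. Qed.

Lemma jac_const (a : K) q r : jac a%:MP q r = 0.
Proof. rewrite jac.unlock !mderivC; ring. Qed.

(** The three-form dp dq dr is the exterior derivative of p dq dr. *)
Lemma jac_div p q r :
  jac p q r = (p * (q^`M(i2) * r^`M(i3) - q^`M(i3) * r^`M(i2)))^`M(i1)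
            + (p * (q^`M(i3) * r^`M(i1) - q^`M(i1) * r^`M(i3)))^`M(i2)
            + (p * (q^`M(i1) * r^`M(i2) - q^`M(i2) * r^`M(i1)))^`M(i3).
Proof.
rewrite jac.unlock !(mderivM, mderivB).
rewrite ?(mderiv_comm i2 i1 q) ?(mderiv_comm i3 i1 q) ?(mderiv_comm i3 i2 q).
rewrite ?(mderiv_comm i2 i1 r) ?(mderiv_comm i3 i1 r) ?(mderiv_comm i3 i2 r).
ring.
Qed.

End Jacobian.

Section FormFunctional.
Variables (R : realType) (b : R[i]).
Local Notation K := R[i].
Local Notation P := {mpoly K[3]}.
Local Notation A := (Mb b).
Local Notation F := (cubic (b + 2) : P).
Local Notation res := (@res R b).

Variable phi : {linear P -> K^o}.
Hypothesis phiF : forall g i, phi (F * g)^`M(i) = 0.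

Let phi_jacF g q r : phi (jac (F * g) q r) = 0.
Proof.
have div0 u v w : phi ((F * g * u)^`M(i1) + (F * g * v)^`M(i2) + (F * g * w)^`M(i3)) = 0.
  by rewrite (raddfD phi) (raddfD phi) /= -(mulrA F g u) -(mulrA F g v) -(mulrA F g w)
       !phiF !addr0.
by rewrite jac_div; apply: div0.
Qed.

(** In the first argument, changing the lift by a multiple of F adds the divergence of
    F times a vector field, by [jac_div]; the other arguments follow by
    antisymmetry. *)
Lemma phi_jac_res p p' q q' r r' :
  res p = res p' -> res q = res q' -> res r = res r' ->
  phi (jac p q r) = phi (jac p' q' r').
Proof.
have tr12 u v w : phi (jac u v w) = - phi (jac v u w).
  by rewrite -(raddfN phi) -jac_tr12.
have tr23 u v w : phi (jac u v w) = - phi (jac u w v).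
  by rewrite -(raddfN phi) -jac_tr23.
have shift1 u u' v w : res u = res u' -> phi (jac u v w) = phi (jac u' v w).
  move=> /res_eq[g ->]; rewrite jacD (raddfD phi) -[RHS]addr0.
  by congr (_ + _); apply: phi_jacF.
have shift2 u v v' w : res v = res v' -> phi (jac u v w) = phi (jac u v' w).
  by move=> E; rewrite (tr12 u v w) (tr12 u v' w) (shift1 v v' u w E).
have shift3 u v w w' : res w = res w' -> phi (jac u v w) = phi (jac u v w').
  by move=> E; rewrite (tr23 u v w) (tr23 u v w') (shift2 u w w' v E).
by move=> Ep Eq Er; rewrite (shift1 _ _ _ _ Ep) (shift2 _ _ _ _ Eq) (shift3 _ _ _ _ Er).
Qed.

(** The value of [phi] on the derivative of a lift of a dt_0 dt_1. Here [repr]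
    chooses the lifts, and [form_momentE] shows that the choice is irrelevant. *)
Definition form_moment (t : 2.-tuple A) (a : A) : K^o :=
  phi (jac (repr a) (repr (tnth t ord0)) (repr (tnth t ord_max))).

Lemma form_momentE p q r (t : 2.-tuple A) :
  tnth t ord0 = res q -> tnth t ord_max = res r ->
  form_moment t (res p) = phi (jac p q r).
Proof. by move=> Eq Er; apply: phi_jac_res; rewrite res_repr. Qed.

Fact form_momentB t : {morph form_moment t : x y / x - y}.
Proof.
move=> x y; rewrite -(res_repr x) -(res_repr y) -rmorphB.
rewrite !(@form_momentE _ (repr (tnth t ord0)) (repr (tnth t ord_max))) ?res_repr //.
by rewrite jacB (raddfB phi).
Qed.

Definition form_functional (w : Omega A 2) : K^o := free_sum form_moment (repr (w : OmegaA A 2)).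

Let form_moment_sum := free_sum form_moment.

Fact form_moment_sum_is_zmod_morphism : zmod_morphism form_moment_sum.
Proof. exact: (free_sum_is_zmod_morphism form_momentB). Qed.

HB.instance Definition _ :=
  GRing.isZmodMorphism.Build _ _ form_moment_sum form_moment_sum_is_zmod_morphism.

Let form_moment_sumU a t : form_moment_sum << a *g t >> = form_moment t a.
Proof. exact: (free_sumU form_momentB). Qed.

Let ord2P (Q : 'I_2 -> Prop) : Q ord0 -> Q ord_max -> forall i, Q i.
Proof.
move=> Q0 Q1 [[|[|i]] //= lt_i]; [have := Q0|have := Q1]; congr Q; exact/val_inj.
Qed.

Let form_moment_upd t i : exists e r, forall a u,
  form_moment (upd t i (res u)) (res a) = e * phi (jac a u r).
Proof.
elim/ord2P: i.
  exists 1, (repr (tnth t ord_max)) => a u; rewrite mul1r.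
  by apply: form_momentE; rewrite tnth_mktuple ?res_repr.
exists (- 1), (repr (tnth t ord0)) => a u.
rewrite mulN1r -(raddfN phi) -jac_tr23.
by apply: form_momentE; rewrite tnth_mktuple ?res_repr.
Qed.

(** Being the derivative of a lift, the determinant satisfies the relations of
    Kaehler forms. The Leibniz rule is the only one that is not immediate, since the
    coefficient is differentiated too; it is [jac_leibniz]. *)
Fact form_moment_sum_kahler D : D \in kahler_submod A 2 -> form_moment_sum D = 0.
Proof.
move=> /asboolP[s [relS ->]]; rewrite raddf_sum big_seq big1 // => -[a E] /=.
move/relS => /= {relS}; rewrite -[a]res_repr; set p := repr a.
move=> [{E}t i u v|{E}t i k|{E}t i u v|{E}t i j ij tij].
- have [e [r sE]] := form_moment_upd t i.
  rewrite !scalerBr !raddfB /= -!freegUZ !form_moment_sumU -[u]res_repr -[v]res_repr -rmorphD.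
  by rewrite !sE jacDm (raddfD phi) mulrDr /= addrAC addrK subrr.
- have [e [r sE]] := form_moment_upd t i.
  by rewrite -freegUZ form_moment_sumU -res_const sE jac_constm (raddf0 phi) mulr0.
- have [e [r sE]] := form_moment_upd t i.
  rewrite !scalerBr !raddfB /= [<< u *g _ >>]freegUZ [<< v *g _ >>]freegUZ !scalerA.
  rewrite -!freegUZ !form_moment_sumU -[u]res_repr -[v]res_repr -!rmorphM !sE.
  by rewrite jac_leibniz (raddfD phi) mulrDr /= addrAC addrK subrr.
rewrite -freegUZ form_moment_sumU -(res_repr (tnth t i)) in tij *.
have -> : form_moment t (res p) = phi (jac p (repr (tnth t ord0)) (repr (tnth t ord0))).
  apply: form_momentE; rewrite res_repr //.
  by move: i j ij tij; elim/ord2P; elim/ord2P => // _; rewrite res_repr.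
by rewrite jac_diag (raddf0 phi).
Qed.

Lemma form_functional_proj D :
  form_functional (mproj (kahler_submod A 2) D) = form_moment_sum D.
Proof.
apply/eqP; rewrite -subr_eq0 -[_ - _](raddfB form_moment_sum); apply/eqP/form_moment_sum_kahler.
by apply/mprojP; rewrite mproj_surj.
Qed.

Fact form_functional_is_zmod_morphism : zmod_morphism form_functional.
Proof.
move=> v w; rewrite -(mproj_surj (v : OmegaA A 2)) -(mproj_surj (w : OmegaA A 2)).
by rewrite -[_ - _]raddfB !form_functional_proj raddfB.
Qed.

HB.instance Definition _ :=
  GRing.isZmodMorphism.Build _ _ form_functional form_functional_is_zmod_morphism.

Lemma form_functionalE p q r :
  form_functional (diff_form (res p) [tuple res q; res r]) = phi (jac p q r).
Proof.
rewrite /diff_form /wedge -linearZ form_functional_proj -freegUZ form_moment_sumU.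
exact: form_momentE.
Qed.

(** An exact form is a sum of forms dr ds with coefficient 1, and d1 = 0. *)
Lemma form_functional_exact (w : Omega A 1) : form_functional (d w) = 0.
Proof.
rewrite -(mproj_surj (w : OmegaA A 1)) dE /dfree (raddf_sum form_functional) big1 // => t _ /=.
rewrite -[wedge _]scale1r -(rmorph1 res) -(mpolyC1).
rewrite (_ : [tuple of _ :: _] = [tuple res (repr (coeff t (repr w))); res (repr (tnth t ord0))]).
  by rewrite [LHS]form_functionalE jac_const (raddf0 phi).
by apply: eq_from_tnth; elim/ord2P; rewrite !(tnth_nth 0) /= res_repr // (tnth_nth 0).
Qed.

End FormFunctional.

(** * Forms in coordinates *)

Lemma sum3 (V : zmodType) (f : 'I_3 -> V) : \sum_i f i = f i1 + f i2 + f i3.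
Proof.
rewrite !big_ord_recl big_ord0 addr0 addrA.
by congr (f _ + f _ + f _); apply/val_inj.
Qed.

Section Coordinates.
Variables (R : realType) (b : R[i]).
Local Notation K := R[i].
Local Notation P := {mpoly K[3]}.
Local Notation A := (Mb b).
Local Notation F := (cubic (b + 2) : P).
Local Notation res := (@res R b).

Lemma mpoly_ring_ind (Q : P -> Prop) :
  (forall a, Q a%:MP) -> (forall i, Q 'X_i) ->
  (forall p q, Q p -> Q q -> Q (p + q)) -> (forall p q, Q p -> Q q -> Q (p * q)) ->
  forall p, Q p.
Proof.
move=> QC QX QD QM p; rewrite (mpolyE p).
elim/big_ind: _ => [||m _]; [by rewrite -mpolyC0 | exact: QD |].
rewrite -mul_mpolyC; apply: (QM) => //; rewrite mpolyXE_id.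
elim/big_ind: _ => [||i _]; [by rewrite -mpolyC1 | exact: QM |].
elim: (m i) => [|k IH]; first by rewrite expr0 -mpolyC1.
by rewrite exprS; apply: QM.
Qed.

(** The chain rule dp = sum of d_i p dx_i. Both sides are additive and satisfy
    the Leibniz rule, so it is enough to compare them on constants and
    variables. *)
Lemma wedge_chain n (t : n.-tuple A) p :
  wedge [tuple of res p :: t] = \sum_i res p^`M(i) *: wedge [tuple of res 'X_i :: t].
Proof.
have swap (M : lmodType A) (r s r' s' : A) (m : M) :
  (r * s) *: m + (r' * s') *: m = (s' * r') *: m + (r * s) *: m.
  by rewrite addrC [r' * s']mulrC.
elim/mpoly_ring_ind: p => [a|i|p q IHp IHq|p q IHp IHq].
- rewrite consE res_const wedge_const big1 // => i _.
  by rewrite mderivC rmorph0 scale0r.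
- rewrite (bigD1 i) //= mderivXi eqxx rmorph1 scale1r big1 ?addr0 // => j ji.
  by rewrite mderivXi eq_sym (negPf ji) rmorph0 scale0r.
- rewrite consE rmorphD wedgeD -!consE IHp IHq -big_split; apply: eq_bigr => i _.
  by rewrite mderivD rmorphD scalerDl.
rewrite consE rmorphM wedgeM -!consE IHp IHq !scaler_sumr -big_split.
apply: eq_bigr => i _ /=; rewrite mderivM rmorphD !rmorphM scalerDl !scalerA.
exact: swap.
Qed.

Local Notation x i := (res 'X_i).
Local Notation w i j p := (diff_form (res p) [tuple x i; x j]).

Lemma wedge2_tr (u v : A) : wedge [tuple u; v] = - wedge [tuple v; u].
Proof.
have upd1 c : upd [tuple 0] ord0 c = [tuple c] :> 1.-tuple A.
  by apply: eq_from_tnth => i; rewrite tnth_mktuple ord1 eqxx.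
have := wedge_swap [tuple 0] ord0 u v; rewrite !upd1 => /eqP.
by rewrite addr_eq0 => /eqP.
Qed.

Lemma wedge2_diag (u : A) : wedge [tuple u; u] = 0.
Proof. exact: (@wedge_alt _ _ _ _ ord0 ord_max). Qed.

Lemma wedge2_chain p (v : A) :
  wedge [tuple res p; v] = \sum_i res p^`M(i) *: wedge [tuple x i; v].
Proof.
have E u : [tuple u; v] = [tuple of u :: [tuple v]] by apply: val_inj.
by rewrite E wedge_chain; apply: eq_bigr => i _; rewrite -E.
Qed.

Lemma formD (t : 2.-tuple A) p q :
  diff_form (res (p + q)) t = diff_form (res p) t + diff_form (res q) t.
Proof. by rewrite /diff_form rmorphD scalerDl. Qed.

Lemma formZ (t : 2.-tuple A) a p :
  diff_form (res (a *: p)) t = a *: diff_form (res p) t.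
Proof. by rewrite res_scale -(mulr_algl a (res p)) /diff_form -scalerA. Qed.

Lemma d_form1 j q :
  d (diff_form (res q) [tuple x j]) = w i1 j q^`M(i1) + w i2 j q^`M(i2) + w i3 j q^`M(i3).
Proof.
rewrite d_form /diff_form scale1r.
rewrite (_ : [tuple of _ :: _] = [tuple res q; x j]); last exact: val_inj.
rewrite wedge2_chain; exact: sum3.
Qed.

Definition basis_form (i : 'I_5) : Omega A 2 :=
  nth 0 [:: w i2 i3 'X_i1; w i2 i3 ('X_i1 ^+ 2); w i2 i3 ('X_i1 * 'X_i2);
            w i2 i3 ('X_i1 * 'X_i3); w i2 i3 ('X_i1 ^+ 3)] i.

End Coordinates.

(** * Every two-form is spanned modulo exact forms *)

Section SpannedModulo.
Variables (K : nzRingType) (U V : lmodType K) (m : nat).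
Variables (e : 'I_m -> V) (delta : {linear U -> V}).

Definition spanned (v : V) : Prop :=
  exists (c : 'I_m -> K) (eta : U), v = \sum_i c i *: e i + delta eta.

Lemma spannedD u v : spanned u -> spanned v -> spanned (u + v).
Proof.
move=> [c [eta ->]] [c' [eta' ->]]; exists (fun i => c i + c' i), (eta + eta').
rewrite raddfD addrACA -big_split; congr (_ + _).
by apply: eq_bigr => i _; rewrite scalerDl.
Qed.

Lemma spannedZ a v : spanned v -> spanned (a *: v).
Proof.
move=> [c [eta ->]]; exists (fun i => a * c i), (a *: eta).
rewrite scalerDr scaler_sumr linearZ_LR; congr (_ + _).
by apply: eq_bigr => i _; rewrite scalerA.
Qed.

Lemma spanned_exact eta : spanned (delta eta).
Proof. by exists (fun=> 0), eta; rewrite big1 ?add0r // => i _; rewrite scale0r. Qed.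

Lemma spanned0 : spanned 0.
Proof. by rewrite -(raddf0 delta); apply: spanned_exact. Qed.

Lemma spannedN v : spanned v -> spanned (- v).
Proof. by rewrite -scaleN1r; apply: spannedZ. Qed.

Lemma spanned_gen i : spanned (e i).
Proof.
exists (fun j => (j == i)%:R), 0; rewrite raddf0 addr0 (bigD1 i) //= eqxx scale1r.
by rewrite big1 ?addr0 // => j /negPf ->; rewrite scale0r.
Qed.

End SpannedModulo.

(** [w12], [w13], [w23] stand for the forms p dx1 dx2, p dx1 dx3, p dx2 dx3 and [S]
    for the span of the five forms modulo exact ones. The derivatives of q dx2 and
    of q dx3 give [exact2] and [exact3]. *)
Section TwoForms.
Variables (K : numFieldType) (c : K).
Local Notation P := {mpoly K[3]}.
Local Notation F := (cubic c).
Variables (V : lmodType K) (S : V -> Prop) (w12 w13 w23 : P -> V).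

Hypothesis SD : forall u v, S u -> S v -> S (u + v).
Hypothesis SZ : forall a v, S v -> S (a *: v).
Hypothesis w23D : forall p q, w23 (p + q) = w23 p + w23 q.
Hypothesis w23Z : forall a p, w23 (a *: p) = a *: w23 p.
Hypothesis w12F : forall g, w12 (F * g) = 0.
Hypothesis w13F : forall g, w13 (F * g) = 0.
Hypothesis w23F : forall g, w23 (F * g) = 0.
Hypothesis exact2 : forall q, S (w12 q^`M(i1) - w23 q^`M(i3)).
Hypothesis exact3 : forall q, S (w13 q^`M(i1) + w23 q^`M(i2)).
Hypothesis S1 : S (w23 'X_i1).
Hypothesis S2 : S (w23 ('X_i1 ^+ 2)).
Hypothesis S3 : S (w23 ('X_i1 * 'X_i2)).
Hypothesis S4 : S (w23 ('X_i1 * 'X_i3)).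
Hypothesis S5 : S (w23 ('X_i1 ^+ 3)).

Let S0 : S 0. Proof. by rewrite -(scale0r (w23 'X_i1)); apply: SZ. Qed.
Let SN v : S v -> S (- v). Proof. by rewrite -scaleN1r; apply: SZ. Qed.
Let SB u v : S u -> S v -> S (u - v). Proof. by move=> Su Sv; apply: SD => //; apply: SN. Qed.

(** If h does not involve x1 and H is its antiderivative in x2, then
    d (H dx3) = h dx2 dx3. *)
Lemma x1_free_exact h : h^`M(i1) = 0 -> S (w23 h).
Proof.
move=> h0; have := exact3 (antideriv i2 h).
rewrite antiderivK mderiv_antideriv // h0.
have -> : antideriv i2 0 = F * 0 :> P by rewrite mulr0 /antideriv raddf0.
by rewrite w13F add0r.
Qed.

Lemma same_mderiv1 p q : p^`M(i1) = q^`M(i1) -> S (w23 p) -> S (w23 q).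
Proof.
move=> E Sp; rewrite -(subrKC p q) w23D; apply: SD => //; apply: x1_free_exact.
by rewrite mderivB E subrr.
Qed.

(** By [same_mderiv1], whether p dx2 dx3 lies in S depends only on d_1 p. The
    polynomials d_1 p for which it does contain 1, x1, x2, x3, x1^2 and all
    d_i (F g), and so [cubic_reduction] applies. For i = 2, 3 the antiderivative of
    d_i (F g) in x1 is d_i G with d_1 G = F g, and the derivative of G dx3 or
    G dx2 moves d_i G dx2 dx3 to a form with coefficient F g, which is zero. *)
Lemma spanned23 p : S (w23 p).
Proof.
suff SI : forall q, S (w23 (antideriv i1 q)).
  by apply: same_mderiv1 (SI p^`M(i1)); rewrite antiderivK.
have prim (r : P) : S (w23 r) -> S (w23 (antideriv i1 r^`M(i1))).
  by apply: same_mderiv1; rewrite antiderivK.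
have primZ a (r : P) : S (w23 r) -> S (w23 (antideriv i1 (a *: r^`M(i1)))).
  by move=> Sr; rewrite -mderivZ; apply: prim; rewrite w23Z; apply: SZ.
have half n (r : P) : n.+1%:R^-1 *: (n.+1%:R * r) = r.
  by rewrite -mpolyC_nat mul_mpolyC scalerA mulVf ?scale1r // pnatr_eq0.
apply: (@cubic_reduction K c (fun q => S (w23 (antideriv i1 q)))).
- by move=> q r Sq Sr; rewrite /antideriv raddfD w23D; apply: SD.
- by move=> a q Sq; rewrite /antideriv linearZ w23Z; apply: SZ.
- move=> g; elim/ord3P.
  + by apply: prim; rewrite w23F.
  + rewrite -mderiv_antideriv //.
    by have := exact3 (antideriv i1 (F * g)); rewrite antiderivK w13F add0r.
  + rewrite -mderiv_antideriv // -[w23 _]opprK; apply: SN.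
    by have := exact2 (antideriv i1 (F * g)); rewrite antiderivK w12F add0r.
- by have := prim _ S1; rewrite mderivXi.
- have := primZ 2^-1 _ S2; rewrite mderivXn mderivXi /= expr1 mulr1.
  by rewrite (half 1).
- by have := prim _ S3; rewrite mderivM !mderivXi mul1r mulr0 addr0.
- by have := prim _ S4; rewrite mderivM !mderivXi mul1r mulr0 addr0.
have := primZ 3^-1 _ S5; rewrite mderivXn mderivXi /= mulr1.
by rewrite (half 2).
Qed.

(** A form p dx1 dx3 or p dx1 dx2 becomes a multiple of dx2 dx3 modulo the
    derivative of G dx3 or G dx2, where d_1 G = p. *)
Lemma two_forms_reduce :
  [/\ forall p, S (w12 p), forall p, S (w13 p) & forall p, S (w23 p)].
Proof.
split=> p; last exact: spanned23.
- have := SD (exact2 (antideriv i1 p)) (spanned23 (antideriv i1 p)^`M(i3)).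
  by rewrite antiderivK subrK.
have := SB (exact3 (antideriv i1 p)) (spanned23 (antideriv i1 p)^`M(i2)).
by rewrite antiderivK addrK.
Qed.

End TwoForms.

Section Spanning.
Variables (R : realType) (b : R[i]).
Local Notation K := R[i].
Local Notation P := {mpoly K[3]}.
Local Notation A := (Mb b).
Local Notation F := (cubic (b + 2) : P).
Local Notation res := (@res R b).
Local Notation x i := (res 'X_i).
Local Notation w i j p := (diff_form (res p) [tuple x i; x j]).
Local Notation S := (spanned (@basis_form R b) (@d K A 1)).

Lemma form_tr i j p : w i j p = - w j i p.
Proof. by rewrite /diff_form wedge2_tr scalerN. Qed.

Lemma form_diag i p : w i i p = 0.
Proof. by rewrite /diff_form wedge2_diag scaler0. Qed.

Lemma formF (t : 2.-tuple A) g : diff_form (res (F * g)) t = 0.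
Proof. by rewrite /diff_form res_F scale0r. Qed.

Lemma spanned_exact2 q : S (w i1 i2 q^`M(i1) - w i2 i3 q^`M(i3)).
Proof.
have : S (d (diff_form (res q) [tuple x i2])) by apply: spanned_exact.
by rewrite d_form1 form_diag addr0 (form_tr i3 i2).
Qed.

Lemma spanned_exact3 q : S (w i1 i3 q^`M(i1) + w i2 i3 q^`M(i2)).
Proof.
have : S (d (diff_form (res q) [tuple x i3])) by apply: spanned_exact.
by rewrite d_form1 form_diag addr0.
Qed.

Let gen i : S (basis_form b i). Proof. exact: spanned_gen. Qed.

Lemma spanned_wij i j p : S (w i j p).
Proof.
have [S12 S13 S23] :
    [/\ forall q, S (w i1 i2 q), forall q, S (w i1 i3 q) & forall q, S (w i2 i3 q)].
  have SD u v : S u -> S v -> S (u + v) by apply: spannedD.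
  have SZ a v : S v -> S (a *: v) by apply: spannedZ.
  apply: (@two_forms_reduce K (b + 2) _ S (fun p => w i1 i2 p) (fun p => w i1 i3 p)
    (fun p => w i2 i3 p) SD SZ (formD _) (formZ _) (@formF _) (@formF _) (@formF _)
    spanned_exact2 spanned_exact3 (gen (@Ordinal 5 0 isT)) (gen (@Ordinal 5 1 isT))
    (gen (@Ordinal 5 2 isT)) (gen (@Ordinal 5 3 isT)) (gen (@Ordinal 5 4 isT))).
elim/ord3P: i; elim/ord3P: j; rewrite ?form_diag //.
- exact: spanned0.
- by rewrite form_tr; apply: spannedN.
- exact: spanned0.
- by rewrite form_tr; apply: spannedN.
- by rewrite form_tr; apply: spannedN.
exact: spanned0.
Qed.

Lemma spanned_sum (f : 'I_3 -> Omega A 2) : (forall i, S (f i)) -> S (\sum_i f i).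
Proof. by move=> Sf; rewrite sum3; apply: spannedD; first apply: spannedD. Qed.

Lemma form_chain p q (v : A) :
  diff_form (res p) [tuple res q; v]
  = \sum_i diff_form (res (p * q^`M(i))) [tuple x i; v] :> Omega A 2.
Proof.
rewrite /diff_form wedge2_chain scaler_sumr; apply: eq_bigr => i _.
by rewrite scalerA -rmorphM.
Qed.

Lemma spanned_form p q r : S (diff_form (res p) [tuple res q; res r]).
Proof.
rewrite form_chain; apply: spanned_sum => i.
have -> m : diff_form (res m) [tuple x i; res r] = - diff_form (res m) [tuple res r; x i].
  by rewrite /diff_form wedge2_tr scalerN.
apply: spannedN; rewrite form_chain; apply: spanned_sum => j; exact: spanned_wij.
Qed.

Lemma all_spanned v : S v.
Proof.
rewrite -(mproj_surj (v : OmegaA A 2)) -(freeg_sumE (repr (v : OmegaA A 2))).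
rewrite (raddf_sum (mproj (kahler_submod A 2))).
elim/big_ind: _ => [|u u' Su Su'|t _]; [exact: spanned0 | exact: spannedD |].
set a := coeff t _; suff: S (diff_form a t).
  by rewrite /diff_form -(linearZ_LR (mproj (kahler_submod A 2))) -freegUZ.
rewrite -(res_repr a).
rewrite (_ : t = [tuple res (repr (tnth t ord0)); res (repr (tnth t ord_max))]).
  exact: spanned_form.
apply: eq_from_tnth => i; rewrite !res_repr !(tnth_nth 0) /=.
by case: i => [[|[|i]] lt_i].
Qed.

End Spanning.

(** * Two-forms are closed on the smooth surface *)

(** Modulo F_1, F_2, F_3 the squares x1^2, x2^2, x3^2 coincide and
    (x2 x3)^2 = 4 x1^2, hence x1^4 = 4 x1^2; modulo F in addition, x1^2 = c. So
    c^2 = 4 c in the quotient, and the coefficients below record these steps. *)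
Lemma jacobian_ideal (K : numFieldType) (c : K) (F := cubic c)
    (x := 'X_i1 : {mpoly K[3]}) (y := 'X_i2 : {mpoly K[3]}) (z := 'X_i3 : {mpoly K[3]}) :
  (2 * (c ^+ 2 - 4 * c))%:MP
  = (x ^+ 2 * x + y ^+ 2 * x - 2 * (2 * x + y * z)) * F^`M(i1)
    + (y * (x ^+ 2 + c%:MP - 4) - x ^+ 2 * y) * F^`M(i2)
    + (z * (x ^+ 2 + c%:MP - 4) - y ^+ 2 * z) * F^`M(i3)
    - 2 * (x ^+ 2 + c%:MP - 4) * F.
Proof.
rewrite {}/F cubic_mderiv1 cubic_mderiv2 cubic_mderiv3 cubic.unlock {}/x {}/y {}/z.
rewrite expr2 !(mpolyCM, mpolyCB) !mpolyC_nat; ring.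
Qed.

Section Closed.
Variables (R : realType) (b : R[i]) (hb : b ^+ 2 != 4).
Local Notation K := R[i].
Local Notation P := {mpoly K[3]}.
Local Notation A := (Mb b).
Local Notation F := (cubic (b + 2) : P).
Local Notation res := (@res R b).
Local Notation x i := (res 'X_i).

(** dF = 0 on the surface. *)
Lemma cubic_chain (t : 2.-tuple A) :
  res F^`M(i1) *: wedge [tuple of x i1 :: t] + res F^`M(i2) *: wedge [tuple of x i2 :: t]
  + res F^`M(i3) *: wedge [tuple of x i3 :: t] = 0.
Proof.
have <- : wedge [tuple of res F :: t] = 0.
  have -> : res F = 0 by rewrite -[F in LHS]mulr1 res_F.
  exact: wedge_cons0.
exact: esym (etrans (wedge_chain t F) (sum3 _)).
Qed.

Lemma wedge3_tr12 (u v r : A) :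
  wedge [tuple of u :: [tuple v; r]] = - wedge [tuple of v :: [tuple u; r]].
Proof.
have updE y : upd [tuple 0; r] ord0 y = [tuple y; r].
  apply: eq_from_tnth => i; rewrite tnth_mktuple !(tnth_nth 0).
  by case: i => [[|[|i]] lt_i].
have := wedge_swap [tuple 0; r] ord0 u v; rewrite !updE => /eqP.
by rewrite addr_eq0 => /eqP.
Qed.

Lemma wedge3_tr13 (u v r : A) :
  wedge [tuple of u :: [tuple v; r]] = - wedge [tuple of r :: [tuple v; u]].
Proof.
have updE y : upd [tuple v; 0] ord_max y = [tuple v; y].
  apply: eq_from_tnth => i; rewrite tnth_mktuple !(tnth_nth 0).
  by case: i => [[|[|i]] lt_i].
have := wedge_swap [tuple v; 0] ord_max u r; rewrite !updE => /eqP.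
by rewrite addr_eq0 => /eqP.
Qed.

Lemma wedge3_diag12 (u v : A) : wedge [tuple of u :: [tuple u; v]] = 0.
Proof. exact: (@wedge_alt _ _ _ _ i1 i2). Qed.

Lemma wedge3_diag13 (u v : A) : wedge [tuple of u :: [tuple v; u]] = 0.
Proof. exact: (@wedge_alt _ _ _ _ i1 i3). Qed.

Let W := wedge [tuple of x i1 :: [tuple x i2; x i3]].

(** Multiply dF = 0 by dx2 dx3, dx1 dx3 and dx2 dx1: each time one term is
    left. *)
Lemma cubic_mderiv_volume i : res F^`M(i) *: W = 0.
Proof.
elim/ord3P: i.
- have := cubic_chain [tuple x i2; x i3].
  by rewrite wedge3_diag12 wedge3_diag13 !scaler0 !addr0.
- have := cubic_chain [tuple x i1; x i3].
  rewrite wedge3_diag12 wedge3_diag13 !scaler0 addr0 add0r wedge3_tr12 scalerN.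
  by move/eqP; rewrite oppr_eq0 => /eqP.
have := cubic_chain [tuple x i2; x i1].
rewrite wedge3_diag12 wedge3_diag13 !scaler0 !add0r wedge3_tr13 scalerN.
by move/eqP; rewrite oppr_eq0 => /eqP.
Qed.

Lemma volume_eq0 : W = 0.
Proof.
have annM a i : res (a * F^`M(i)) *: W = 0.
  by rewrite rmorphM -scalerA cubic_mderiv_volume scaler0.
have annD p q : res p *: W = 0 -> res q *: W = 0 -> res (p + q) *: W = 0.
  by move=> Wp Wq; rewrite rmorphD scalerDl Wp Wq addr0.
have annF a : res (- (a * F)) *: W = 0.
  by rewrite -mulNr mulrC res_F scale0r.
set e := 2 * ((b + 2) ^+ 2 - 4 * (b + 2)).
have e0 : e != 0.
  rewrite /e (_ : 2 * _ = 2 * (b ^+ 2 - 4)); last by ring.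
  by rewrite mulf_neq0 ?subr_eq0 // pnatr_eq0.
have eW : res e%:MP *: W = 0.
  by rewrite jacobian_ideal; do 3!apply: (annD) => //.
have eA : (e^-1)%:A * e%:A = 1 :> A by rewrite mulr_algl scalerA mulVf // scale1r.
by rewrite -[LHS]scale1r -eA -scalerA -(res_const b e) eW scaler0.
Qed.

Lemma form23_closed p : closed_form (diff_form (res p) [tuple x i2; x i3]).
Proof.
apply/eqP; rewrite d_form /diff_form scale1r wedge_chain sum3.
by rewrite wedge3_diag12 wedge3_diag13 !scaler0 !addr0 -/W volume_eq0 scaler0.
Qed.

End Closed.

(** * Independence, and the basis *)

Lemma jac_x23 (K : numFieldType) (p : {mpoly K[3]}) : jac p 'X_i2 'X_i3 = p^`M(i1).
Proof. rewrite jac.unlock !mderivXi /=; ring. Qed.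

Section CohomologyBasis.
Variables (K : fieldType) (A : comAlgType K) (n m : nat).
Variable omega : 'I_m -> Omega A n.+1.
Hypothesis omega_closed : forall i, closed_form (omega i).

Lemma cohomology_basis :
  (forall v, spanned omega (@d K A n) v) ->
  (forall c eta, \sum_i c i *: omega i = d eta -> forall i, c i = 0) ->
  is_basis (fun i => cohomology_class (omega_closed i)).
Proof.
move=> gen indep.
pose Z i := Cocycle (omega_closed i).
have valZ c : cocycle_val (\sum_i c i *: Z i) = \sum_i c i *: omega i.
  rewrite -[cocycle_val _]/(val _) raddf_sum; apply: eq_bigr => i _.
  exact: cocycle_valZ.
have classE c : \sum_i c i *: cohomology_class (omega_closed i)
    = mproj (coboundary_submod A n.+1) (\sum_i c i *: Z i).
  rewrite raddf_sum; apply: eq_bigr => i _.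
  exact/esym/(linearZ_LR (mproj (coboundary_submod A n.+1))).
split=> [c | v].
  rewrite classE -(raddf0 (mproj _)) => /mprojP; rewrite subr0 => /asboolP[eta].
  by rewrite valZ; apply: indep.
have [c [eta E]] := gen (cocycle_val (repr v)); exists c.
rewrite classE -[LHS]mproj_surj; apply/mprojP/asboolP; exists eta.
rewrite -[cocycle_val _]/(val _) raddfB -!/(cocycle_val _) /= valZ E.
by rewrite addrC addKr.
Qed.

End CohomologyBasis.

Lemma sum5 (V : zmodType) (f : 'I_5 -> V) :
  \sum_i f i = f (@Ordinal 5 0 isT) + f (@Ordinal 5 1 isT) + f (@Ordinal 5 2 isT)
               + f (@Ordinal 5 3 isT) + f (@Ordinal 5 4 isT).
Proof.
rewrite !big_ord_recl big_ord0 addr0 !addrA.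
by congr (f _ + f _ + f _ + f _ + f _); apply/val_inj.
Qed.

Section Independence.
Variables (R : realType) (b : R[i]).
Local Notation K := R[i].
Local Notation P := {mpoly K[3]}.
Local Notation A := (Mb b).
Local Notation res := (@res R b).
Local Notation x i := (res 'X_i).

Definition basis_coef (i : 'I_5) : P :=
  nth 0 [:: 'X_i1; 'X_i1 ^+ 2; 'X_i1 * 'X_i2; 'X_i1 * 'X_i3; 'X_i1 ^+ 3] i.

Lemma basis_formE i : basis_form b i = diff_form (res (basis_coef i)) [tuple x i2; x i3].
Proof. by case: i => [[|[|[|[|[|i]]]]] lt_i]. Qed.

(** The exterior derivatives of the five forms are independent multiples of the
    five monomials on which [cubic_functional] prescribes values. *)
Lemma mderiv_basis_coef (c : 'I_5 -> K) :
  (\sum_i c i *: basis_coef i)^`M(i1)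
  = c (@Ordinal 5 0 isT) *: 1 + (2 * c (@Ordinal 5 1 isT)) *: 'X_i1
   + c (@Ordinal 5 2 isT) *: 'X_i2 + c (@Ordinal 5 3 isT) *: 'X_i3
   + (3 * c (@Ordinal 5 4 isT)) *: 'X_i1 ^+ 2.
Proof.
rewrite (raddf_sum (mderiv i1)) sum5 /= !mderivZ.
rewrite !mderivXn !mderivM !mderivXi /= -!mul_mpolyC !mpolyCM !mpolyC_nat; ring.
Qed.

Lemma basis_form_independent (c : 'I_5 -> K) (eta : Omega A 1) :
  \sum_i c i *: basis_form b i = d eta -> forall i, c i = 0.
Proof.
have formE : \sum_i c i *: basis_form b i
    = diff_form (res (\sum_i c i *: basis_coef i)) [tuple x i2; x i3].
  rewrite /diff_form rmorph_sum scaler_suml; apply: eq_bigr => i _.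
  by rewrite basis_formE -formZ.
rewrite formE => E.
(* The functionals of [cubic_functional], transported to two-forms, kill the exact
   side of E. *)
have eq0 v0 vx vy vz vxx : c (@Ordinal 5 0 isT) * v0 + 2 * c (@Ordinal 5 1 isT) * vx
   + c (@Ordinal 5 2 isT) * vy + c (@Ordinal 5 3 isT) * vz
   + 3 * c (@Ordinal 5 4 isT) * vxx = 0.
  have [phi [phiF [p0 px py pz pxx]]] := cubic_functional (b + 2) v0 vx vy vz vxx.
  have := congr1 (form_functional phi) E.
  rewrite (form_functional_exact phiF) (form_functionalE phiF) jac_x23.
  rewrite mderiv_basis_coef !(raddfD phi) /= !(linearZ_LR phi).
  by rewrite p0 px py pz pxx.
have eq0_at v0 vx vy vz vxx e (j : 'I_5) : e != 0 ->
    c (@Ordinal 5 0 isT) * v0 + 2 * c (@Ordinal 5 1 isT) * vx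
    + c (@Ordinal 5 2 isT) * vy + c (@Ordinal 5 3 isT) * vz
    + 3 * c (@Ordinal 5 4 isT) * vxx = e * c j -> c j = 0.
  by rewrite eq0 => e0 /esym/eqP; rewrite mulf_eq0 (negPf e0) => /eqP.
move=> i; have [k ->] : exists k : 'I_5, i = k by exists i.
case: k => [[|[|[|[|[|k]]]]] lt_k] //.
- apply: (eq0_at 1 0 0 0 0 1); first exact: oner_neq0.
  by rewrite (bool_irrelevance lt_k isT); ring.
- apply: (eq0_at 0 1 0 0 0 2); first by rewrite pnatr_eq0.
  by rewrite (bool_irrelevance lt_k isT); ring.
- apply: (eq0_at 0 0 1 0 0 1); first exact: oner_neq0.
  by rewrite (bool_irrelevance lt_k isT); ring.
- apply: (eq0_at 0 0 0 1 0 1); first exact: oner_neq0.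
  by rewrite (bool_irrelevance lt_k isT); ring.
apply: (eq0_at 0 0 0 0 1 3); first by rewrite pnatr_eq0.
by rewrite (bool_irrelevance lt_k isT); ring.
Qed.

End Independence.

Theorem mainTheorem4 (R : realType) (b : R[i]) (hb : b ^+ 2 != 4) :
  let x1 : Mb b := Mb_x1 b in
  let x2 : Mb b := Mb_x2 b in
  let x3 : Mb b := Mb_x3 b in
  let x23 : 2.-tuple (Mb b) := [tuple x2; x3] in
  let omega : 'I_5 -> Omega (Mb b) 2 := fun i =>
    nth 0 [:: diff_form x1 x23;
              diff_form (x1 ^+ 2) x23;
              diff_form (x1 * x2) x23;
              diff_form (x1 * x3) x23;
              diff_form (x1 ^+ 3) x23] i in
  has_dim (HdR (Mb b) 2) 5 /\
  exists omega_closed : forall i : 'I_5, closed_form (omega i),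
    is_basis (fun i : 'I_5 => cohomology_class (omega_closed i)).
Proof.
move=> x1 x2 x3 x23 om.
have -> : om = basis_form b.
  by apply: funext => i; rewrite /basis_form !(rmorphXn (@res R b)) !(rmorphM (@res R b)).
have closed i : closed_form (basis_form b i) by rewrite basis_formE; apply: form23_closed.
have basis := cohomology_basis closed (@all_spanned R b) (@basis_form_independent R b).
by split; [exists (fun i => cohomology_class (closed i)) | exists closed].
Qed.
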